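(* Let $(A,\{\!\!\{-,-\}\!\!\})$ be a double quasi-Poisson algebra, and let $v$ be a cyclic bilinear form on a counital coalgebra $M$. Let $E=\{x\in A_M^+\mid\delta_\varphi(x)=0\text{ for all }\varphi\in M^*\}$. The restriction of the bracket $\{-,-\}_v^+$ in $A_M^+$ to the algebra $E\subset A_M^+$ satisfies the Jacobi identity and makes $E$ into a Poisson algebra.
   Context: All modules, (co)algebras and tensor products are over a fixed commutative ring $\mathbb{K}$; algebras are associative, coalgebras coassociative. Iterated comultiplication in $M$ is written $\alpha\mapsto\alpha^1\otimes\cdots\otimes\alpha^m$ (summation suppressed); $\varepsilon$ is the counit. Elements of $A\otimes A$ are written $x=x'\otimes x''$ (summation suppressed). Everything here is non-graded. Double bracket in an algebra $A$: a linear map $\{\!\!\{-,-\}\!\!\}:A\otimes A\to A\otimes A$ with $\{\!\!\{b,a\}\!\!\}=-P_{21}\{\!\!\{a,b\}\!\!\}$ ($P_{21}$ the flip), $\{\!\!\{a,bc\}\!\!\}=\{\!\!\{a,b\}\!\!\}c+b\{\!\!\{a,c\}\!\!\}$ and $\{\!\!\{ab,c\}\!\!\}=a*\{\!\!\{b,c\}\!\!\}+\{\!\!\{a,c\}\!\!\}*b$, where $a(x\otimes y)b=ax\otimes yb$ and $a*(x\otimes y)*b=xb\otimes ay$. Its tribracket is $\{\!\!\{-,-,-\}\!\!\}=\sum_{i=0}^2P_{312}^i(\{\!\!\{-,-\}\!\!\}\otimes\mathrm{id}_A)(\mathrm{id}_A\otimes\{\!\!\{-,-\}\!\!\})P_{312}^{-i}$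 on $A^{\otimes3}$, $P_{312}(a_1\otimes a_2\otimes a_3)=a_3\otimes a_1\otimes a_2$. Double quasi-Poisson algebra: a unital (non-graded) algebra $A$ with a double bracket such that for all $a,b,c\in A$ $$\{\!\!\{a,b,c\}\!\!\}=c\otimes a\otimes b+1_A\otimes ab\otimes c+a\otimes1_A\otimes bc+ca\otimes b\otimes1_A-a\otimes b\otimes c-1_A\otimes a\otimes bc-ca\otimes1_A\otimes b-c\otimes ab\otimes1_A.$$ Cyclic form: $v:M\otimes M\to\mathbb{K}$ is cyclic if $\widehat v(\alpha\otimes\beta)=v(\alpha\otimes\beta^2)\beta^1\otimes\beta^3$ defines an endomorphism of $M\otimes M$ commuting with the flip. Representation algebras: $A_M$ is the commutative algebra generated by symbols $a_\alpha$ ($a\in A$, $\alpha\in M$) subject to bilinearity in $(a,\alpha)$ and $(ab)_\alpha=a_{\alpha^1}b_{\alpha^2}$. $A_M^+$ is the quotient of $\mathbb{K}e\oplus A_M$ (adjoining a two-sided unit $e$) by the relations $(1_A)_\alpha=\varepsilon(\alpha)e$, $\alpha\in M$. Bracket: $\{-,-\}_v$ is the unique antisymmetric biderivation (Leibniz rule in each variable) in $A_M$ with $\{a_\alpha,b_\beta\}_v=v(\alpha\otimes\beta^2)\{\!\!\{a,b\}\!\!\}'_{\beta^1}\{\!\!\{a,b\}\!\!\}''_{\beta^3}$ for $a,b\in A$, $\alpha,\beta\in M$; extended to $\mathbb{K}e\oplus A_M$ by annihilating $e$ on both sides, it descends to an antisymmetric biderivation $\{-,-\}_v^+$ in $A_M^+$.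 Derivations: for $\varphi\in M^*=\mathrm{Hom}_{\mathbb{K}}(M,\mathbb{K})$, $\delta_\varphi(\alpha)=\varphi(\alpha^2)\alpha^1-\varphi(\alpha^1)\alpha^2$ on $M$, and $\delta_\varphi$ also denotes the derivation of $A_M^+$ with $\delta_\varphi(e)=0$ and $\delta_\varphi(a_\alpha)=a_{\delta_\varphi(\alpha)}$. The subalgebra $E$ is closed under $\{-,-\}_v^+$. A Poisson algebra is a commutative algebra with an antisymmetric biderivation satisfying the Jacobi identity. *)

(* Defs.v *)
From HB Require Import structures.
From mathcomp Require Import all_boot all_order all_algebra.
From mathcomp Require Import boolp.

Set Implicit Arguments.
Unset Strict Implicit.
Unset Printing Implicit Defensive.

Import GRing.Theory.
Local Open Scope ring_scope.
Local Open Scope quotient_scope.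

Definition bilinear_map (K : pzRingType) (M N P : lmodType K) (f : M -> N -> P) :=
  (forall y, linear (f^~ y)) /\ (forall x, linear (f x)).

Section LinearE.
Variables (K : pzRingType) (U V : lmodType K).
Implicit Type g : U -> V.

Lemma linearE0 g : linear g -> g 0 = 0.
Proof. by move=> lg; have := lg (-1) 0 0; rewrite scaler0 addr0 scaleN1r addNr. Qed.

Lemma linearED g x y :
  linear g -> g (x + y) = g x + g y.
Proof. by move=> lg; have := lg 1 x y; rewrite !scale1r. Qed.

Lemma linearEZ g k x :
  linear g -> g (k *: x) = k *: g x.
Proof. by move=> lg; have := lg k x 0; rewrite !addr0 linearE0 // addr0. Qed.

Lemma linearEN g x : linear g -> g (- x) = - g x.
Proof. by move=> lg; rewrite -scaleN1r linearEZ // scaleN1r. Qed.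

End LinearE.

(* The tensor product of two modules: finite formal sums of pairs modulo the   *)
(* congruence generated by biadditivity and balancedness.                      *)
Section Tensor.
Variables (K : comPzRingType) (M N : lmodType K).
Implicit Types s t : seq (M * N).

Inductive tensor_eq : seq (M * N) -> seq (M * N) -> Prop :=
| TensRefl s : tensor_eq s s
| TensSym s t : tensor_eq s t -> tensor_eq t s
| TensTrans s t u : tensor_eq s t -> tensor_eq t u -> tensor_eq s u
| TensCat s1 t1 s2 t2 :
    tensor_eq s1 t1 -> tensor_eq s2 t2 -> tensor_eq (s1 ++ s2) (t1 ++ t2)
| TensComm s t : tensor_eq (s ++ t) (t ++ s)
| TensDl x x' y : tensor_eq [:: (x + x', y)] [:: (x, y); (x', y)]
| TensDr x y y' : tensor_eq [:: (x, y + y')] [:: (x, y); (x, y')]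
| TensZ k x y : tensor_eq [:: (k *: x, y)] [:: (x, k *: y)]
| Tens0 y : tensor_eq [:: (0, y)] [::].

Definition tensor_eqb s t := `[< tensor_eq s t >].

Lemma tensor_eqb_refl : reflexive tensor_eqb.
Proof. by move=> s; apply/asboolP; exact: TensRefl. Qed.

Lemma tensor_eqb_sym : symmetric tensor_eqb.
Proof. by move=> s t; apply/asboolP/asboolP; exact: TensSym. Qed.

Lemma tensor_eqb_trans : transitive tensor_eqb.
Proof.
by move=> t s u /asboolP st /asboolP tu; apply/asboolP; exact: TensTrans st tu.
Qed.

Canonical tensor_equiv :=
  EquivRel tensor_eqb tensor_eqb_refl tensor_eqb_sym tensor_eqb_trans.

Definition tensor := {eq_quot tensor_equiv}.

HB.instance Definition _ := Choice.on tensor.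
HB.instance Definition _ := EqQuotient.on tensor.

Definition pure (x : M) (y : N) : tensor := \pi_tensor [:: (x, y)].

(* The linear map induced by a bilinear map f, i.e. f(x', x'') with Sweedler   *)
(* summation over x = x' (x) x''.                                              *)
Definition tlift (P : lmodType K) (f : M -> N -> P) (x : tensor) : P :=
  \sum_(p <- repr x) f p.1 p.2.

Lemma tens_piP s t : \pi_tensor s = \pi_tensor t <-> tensor_eq s t.
Proof.
split=> [/eqmodP/asboolP //|st].
by apply/eqmodP/asboolP.
Qed.

Definition tens_add (x y : tensor) : tensor := \pi_tensor (repr x ++ repr y).
Definition tens_scale (k : K) (x : tensor) : tensor :=
  \pi_tensor [seq (k *: p.1, p.2) | p <- repr x].

Lemma tens_repr s : tensor_eq (repr (\pi_tensor s)) s.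
Proof. by apply/tens_piP; rewrite reprK. Qed.

Lemma tens_add_pi s t :
  tens_add (\pi_tensor s) (\pi_tensor t) = \pi_tensor (s ++ t).
Proof. by apply/tens_piP/TensCat; exact: tens_repr. Qed.

Lemma tensor_eq_map k s t : tensor_eq s t ->
  tensor_eq [seq (k *: p.1, p.2) | p <- s] [seq (k *: p.1, p.2) | p <- t].
Proof.
elim=> {s t} /=.
- by move=> s; exact: TensRefl.
- by move=> s t _; exact: TensSym.
- by move=> s t u _ st _; exact: TensTrans.
- by move=> s1 t1 s2 t2 _ h1 _ h2; rewrite !map_cat; exact: TensCat.
- by move=> s t; rewrite !map_cat; exact: TensComm.
- by move=> x x' y; rewrite scalerDr; exact: TensDl.
- by move=> x y y'; exact: TensDr.
- by move=> l x y; rewrite scalerA mulrC -scalerA; exact: TensZ.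
- by move=> y; rewrite scaler0; exact: Tens0.
Qed.

Lemma tens_scale_pi k s :
  tens_scale k (\pi_tensor s) = \pi_tensor [seq (k *: p.1, p.2) | p <- s].
Proof. by apply/tens_piP/tensor_eq_map; exact: tens_repr. Qed.

Fact tens_addA : associative tens_add.
Proof.
elim/quotW=> s; elim/quotW=> t; elim/quotW=> u.
by rewrite (tens_add_pi t u) (tens_add_pi s t) !tens_add_pi catA.
Qed.

Fact tens_addC : commutative tens_add.
Proof.
elim/quotW=> s; elim/quotW=> t; rewrite !tens_add_pi.
by apply/tens_piP; exact: TensComm.
Qed.

Fact tens_add0 : left_id (\pi_tensor [::]) tens_add.
Proof. by elim/quotW=> s; rewrite tens_add_pi. Qed.

Fact tens_scaleDl x (a b : K) :
  tens_scale (a + b) x = tens_add (tens_scale a x) (tens_scale b x).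
Proof.
elim/quotW: x => s; rewrite !tens_scale_pi tens_add_pi; apply/tens_piP.
elim: s => [|p s IHs] /=; first exact: TensRefl.
rewrite scalerDl -cat1s; apply: TensTrans (TensCat (TensDl _ _ _) IHs) _.
apply: (@TensCat [:: _] [:: _]); first exact: TensRefl.
rewrite -(cat1s (b *: p.1, p.2)) -(cat1s (b *: p.1, p.2) (map _ _)) !catA.
by apply: TensCat; [exact: TensComm|exact: TensRefl].
Qed.

Fact tens_scale0 x : tens_scale 0 x = \pi_tensor [::].
Proof.
elim/quotW: x => s; rewrite tens_scale_pi; apply/tens_piP.
elim: s => [|p s IHs] /=; first exact: TensRefl.
by rewrite scale0r -cat1s; exact: (TensCat (Tens0 _) IHs).
Qed.

Fact tens_scale1 x : tens_scale 1 x = x.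
Proof.
elim/quotW: x => s; rewrite tens_scale_pi; congr (\pi_tensor _).
by rewrite -[RHS]map_id; apply: eq_map => -[a b] /=; rewrite scale1r.
Qed.

Fact tens_addN : left_inverse (\pi_tensor [::]) (tens_scale (-1)) tens_add.
Proof.
by move=> x; rewrite -{2}[x]tens_scale1 -tens_scaleDl addNr tens_scale0.
Qed.

HB.instance Definition _ :=
  GRing.isZmodule.Build tensor tens_addA tens_addC tens_add0 tens_addN.

Fact tens_scaleA a b x : tens_scale a (tens_scale b x) = tens_scale (a * b) x.
Proof.
elim/quotW: x => s; rewrite (tens_scale_pi b) !tens_scale_pi -map_comp.
congr (\pi_tensor _).
by apply: eq_map => p /=; rewrite scalerA.
Qed.

Fact tens_scaleDr : right_distributive tens_scale +%R.
Proof.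
move=> k; elim/quotW=> s; elim/quotW=> t; rewrite /GRing.add /=.
by rewrite !(tens_add_pi, tens_scale_pi) map_cat.
Qed.

HB.instance Definition _ := GRing.Zmodule_isLmodule.Build K tensor
  tens_scaleA tens_scale1 tens_scaleDr tens_scaleDl.

Lemma pi_cons p s : \pi_tensor (p :: s) = pure p.1 p.2 + \pi_tensor s.
Proof. by case: p => x y; rewrite /GRing.add /= tens_add_pi. Qed.

Lemma pi_sum s : \pi_tensor s = \sum_(p <- s) pure p.1 p.2.
Proof. by elim: s => [|p s IHs]; rewrite ?big_nil ?big_cons // pi_cons IHs. Qed.

Lemma tens_sum (x : tensor) : x = \sum_(p <- repr x) pure p.1 p.2.
Proof. by rewrite -pi_sum reprK. Qed.

Lemma pure_bilinear : bilinear_map pure.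
Proof.
have scl k x y : k *: pure x y = pure (k *: x) y by rewrite [LHS]tens_scale_pi.
have scr k x y : k *: pure x y = pure x (k *: y).
  by rewrite scl; apply/tens_piP; exact: TensZ.
split=> [y k x x'|x k y y'].
  by rewrite scl [RHS]tens_add_pi; apply/tens_piP; exact: TensDl.
by rewrite scr [RHS]tens_add_pi; apply/tens_piP; exact: TensDr.
Qed.

Section Lift.
Variables (P : lmodType K) (f : M -> N -> P).

Hypothesis bf : bilinear_map f.

Lemma tlift_pi s : tlift f (\pi_tensor s) = \sum_(p <- s) f p.1 p.2.
Proof.
case: bf => fl fr.
suff H t u : tensor_eq t u -> \sum_(p <- t) f p.1 p.2 = \sum_(p <- u) f p.1 p.2.
  by apply: H; exact: tens_repr.
elim=> {t u} //.
- by move=> t u v _ -> _ ->.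
- by move=> t1 u1 t2 u2 _ h1 _ h2; rewrite !big_cat h1 h2.
- by move=> t u; rewrite !big_cat /= addrC.
- by move=> x x' y; rewrite !big_cons !big_nil /= !addr0 (linearED _ _ (fl y)).
- by move=> x y y'; rewrite !big_cons !big_nil /= !addr0 (linearED _ _ (fr x)).
- move=> k x y; rewrite !big_cons !big_nil /= !addr0.
  by rewrite (linearEZ _ _ (fl y)) (linearEZ _ _ (fr x)).
- by move=> y; rewrite big_cons !big_nil /= addr0 (linearE0 (fl y)).
Qed.

Lemma tlift_pure x y : tlift f (pure x y) = f x y.
Proof. by rewrite tlift_pi big_cons big_nil addr0. Qed.

Lemma tlift_linear : linear (tlift f).
Proof.
case: bf => fl fr k; elim/quotW=> s; elim/quotW=> t.
rewrite [_ *: _]tens_scale_pi [_ + _]tens_add_pi !tlift_pi big_cat big_map /=.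
by congr (_ + _); rewrite scaler_sumr; apply: eq_bigr => p _ /=;
  rewrite (linearEZ _ _ (fl p.2)).
Qed.

End Lift.

Lemma eq_tens_linear (P : lmodType K) (f g : tensor -> P) :
  linear f -> linear g -> (forall x y, f (pure x y) = g (pure x y)) -> f =1 g.
Proof.
move=> lf lg fg; elim/quotW; elim=> [|p s IHs].
  by rewrite -[\pi_tensor [::]]/(0 : tensor) !linearE0.
by rewrite pi_cons !linearED // fg IHs.
Qed.

End Tensor.

Arguments tensor {K} (M N)%_type_scope.

Notation "M ⊗ N" := (tensor M N) (at level 40, left associativity) : type_scope.
Notation "x ⊗ y" := (pure x y) (at level 40, left associativity) : ring_scope.

Section TensorMaps.
Variable K : comPzRingType.
Implicit Types M N P : lmodType K.

Definition tlift3 M N P (Q : lmodType K) (f : M -> N -> P -> Q) :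
    (M ⊗ N ⊗ P)%type -> Q :=
  tlift (fun u z => tlift (fun x y => f x y z) u).

Definition tmap M N M' N' (f : M -> M') (g : N -> N') :
    (M ⊗ N)%type -> (M' ⊗ N')%type :=
  tlift (fun x y => f x ⊗ g y).

Definition tflip M N : (M ⊗ N)%type -> (N ⊗ M)%type :=
  tlift (fun x y => y ⊗ x).

Definition tassoc M N P : (M ⊗ N ⊗ P)%type -> (M ⊗ (N ⊗ P))%type :=
  tlift3 (fun x y z => x ⊗ (y ⊗ z)).

Definition tunassoc M N P : (M ⊗ (N ⊗ P))%type -> (M ⊗ N ⊗ P)%type :=
  tlift (fun x => tlift (fun y z => x ⊗ y ⊗ z)).

(* P312 (x1 (x) x2 (x) x3) = x3 (x) x1 (x) x2, and its inverse P231. *)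
Definition P312 M : (M ⊗ M ⊗ M)%type -> (M ⊗ M ⊗ M)%type :=
  tlift3 (fun x1 x2 x3 => x3 ⊗ x1 ⊗ x2).

Definition P231 M : (M ⊗ M ⊗ M)%type -> (M ⊗ M ⊗ M)%type :=
  tlift3 (fun x1 x2 x3 => x2 ⊗ x3 ⊗ x1).

End TensorMaps.

(* Associative K-algebras with optional unit and commutativity. The library's  *)
(* algType is unital with 1 != 0; neither the algebra of symbols below nor its *)
(* unital quotient (which can be zero) fits into it.                           *)
HB.mixin Record isAssocAlgebra (K : comPzRingType) A of GRing.Lmodule K A := {
  amul : A -> A -> A;
  amulA : associative amul;
  amul_bilinear : bilinear_map amul
}.

#[short(type="assocAlgType")]
HB.structure Definition AssocAlgebra (K : comPzRingType) :=
  {A of isAssocAlgebra K A & GRing.Lmodule K A}.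

HB.mixin Record hasAlgUnit (K : comPzRingType) A of AssocAlgebra K A := {
  aone : A;
  amul1 : left_id aone (@amul K A);
  amul1r : right_id aone (@amul K A)
}.

#[short(type="unitalAlgType")]
HB.structure Definition UnitalAlgebra (K : comPzRingType) :=
  {A of hasAlgUnit K A & AssocAlgebra K A}.

HB.mixin Record isCommAlgebra (K : comPzRingType) A of AssocAlgebra K A := {
  amulC : commutative (@amul K A)
}.

#[short(type="comAssocAlgType")]
HB.structure Definition ComAssocAlgebra (K : comPzRingType) :=
  {A of isCommAlgebra K A & AssocAlgebra K A}.

#[short(type="comUnitalAlgType")]
HB.structure Definition ComUnitalAlgebra (K : comPzRingType) :=
  {A of ComAssocAlgebra K A & UnitalAlgebra K A}.

Notation "x ∙ y" := (amul x y) (at level 40, left associativity) : ring_scope.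

HB.mixin Record isCoalgebra (K : comPzRingType) M of GRing.Lmodule K M := {
  comul : M -> (M ⊗ M)%type;
  counit : M -> K;
  comul_linear : linear comul;
  counit_linear : linear (counit : M -> K^o);
  comulA : forall x : M,
    tassoc (tmap comul idfun (comul x)) = tmap idfun comul (comul x);
  counitl : forall x : M, tlift (fun y z => counit y *: z) (comul x) = x;
  counitr : forall x : M, tlift (fun y z => counit z *: y) (comul x) = x
}.

#[short(type="coalgType")]
HB.structure Definition Coalgebra (K : comPzRingType) :=
  {M of isCoalgebra K M & GRing.Lmodule K M}.

HB.instance Definition _ (K : comPzRingType) (M : coalgType K) :=
  GRing.isLinear.Build K M (M ⊗ M)%type _ (@comul K M) comul_linear.

HB.instance Definition _ (K : comPzRingType) (M : coalgType K) :=
  GRing.isLinear.Build K M K^o _ (@counit K M : M -> K^o) counit_linear.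

Definition comul3 (K : comPzRingType) (M : coalgType K) (x : M) :
    (M ⊗ M ⊗ M)%type :=
  tmap comul idfun (comul x).

Section DoubleBracket.
Variables (K : comPzRingType) (A : assocAlgType K).
Local Notation A2 := (A ⊗ A)%type.
Local Notation A3 := (A ⊗ A ⊗ A)%type.
Implicit Types a b c : A.

(* Outer bimodule structure a (x' (x) x'') b = a x' (x) x'' b and inner one    *)
(* a * (x' (x) x'') * b = x' b (x) a x'' on A (x) A.                           *)
Definition outerl a : A2 -> A2 := tlift (fun x' x'' => (a ∙ x') ⊗ x'').
Definition outerr (t : A2) b : A2 := tlift (fun x' x'' => x' ⊗ (x'' ∙ b)) t.
Definition innerl a : A2 -> A2 := tlift (fun x' x'' => x' ⊗ (a ∙ x'')).
Definition innerr (t : A2) b : A2 := tlift (fun x' x'' => (x' ∙ b) ⊗ x'') t.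

Record double_bracket := DoubleBracket {
  dbr :> A2 -> A2;
  dbr_linear : linear dbr;
  dbr_skew : forall a b, dbr (b ⊗ a) = - tflip (dbr (a ⊗ b));
  dbr_leibr : forall a b c,
    dbr (a ⊗ (b ∙ c)) = outerr (dbr (a ⊗ b)) c + outerl b (dbr (a ⊗ c));
  dbr_leibl : forall a b c,
    dbr ((a ∙ b) ⊗ c) = innerl a (dbr (b ⊗ c)) + innerr (dbr (a ⊗ c)) b
}.

Definition tribracket (d : double_bracket) (t : A3) : A3 :=
  \sum_(i < 3)
    iter i (@P312 K A)
      (tmap d idfun (tunassoc (tmap idfun d (tassoc (iter i (@P231 K A) t))))).

End DoubleBracket.

Definition quasi_Poisson (K : comPzRingType) (A : unitalAlgType K)
    (d : double_bracket A) : Prop :=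
  let e : A := aone in
  forall a b c : A, tribracket d (a ⊗ b ⊗ c) =
    c ⊗ a ⊗ b + e ⊗ (a ∙ b) ⊗ c + a ⊗ e ⊗ (b ∙ c) + (c ∙ a) ⊗ b ⊗ e
    - a ⊗ b ⊗ c - e ⊗ a ⊗ (b ∙ c) - (c ∙ a) ⊗ e ⊗ b - c ⊗ (a ∙ b) ⊗ e.


Section CyclicForm.
Variables (K : comPzRingType) (M : coalgType K).
Local Notation M2 := (M ⊗ M)%type.

(* alpha (x) beta |-> v(alpha (x) beta^2) beta^1 (x) beta^3 *)
Definition form_hat (v : M2 -> K) : M2 -> M2 :=
  tlift (fun al be =>
    tlift3 (fun b1 b2 b3 : M => v (al ⊗ b2) *: (b1 ⊗ b3)) (comul3 be)).

Record cyclic_form := CyclicForm {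
  cform :> M2 -> K;
  cform_linear : linear (cform : M2 -> K^o);
  cform_cyclic : forall t, form_hat cform (tflip t) = tflip (form_hat cform t)
}.

End CyclicForm.


(* The commutative algebra A_M generated by symbols a_alpha subject to         *)
(* bilinearity and (ab)_alpha = a_(alpha^1) b_(alpha^2): terms over the        *)
(* symbols modulo the congruence generated by the axioms of commutative        *)
(* (non-unital) algebras and these relations.                                  *)
Section Representation.
Variables (K : comPzRingType) (A : assocAlgType K) (M : coalgType K).

Inductive rep_term :=
| RGen of A & M
| RZero
| ROpp of rep_term
| RAdd of rep_term & rep_term
| RScale of K & rep_term
| RMul of rep_term & rep_term.

Definition rterm_sum (s : seq (M * M)) (a b : A) : rep_term :=
  foldr (fun p => RAdd (RMul (RGen a p.1) (RGen b p.2))) RZero s.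

Inductive rep_eq : rep_term -> rep_term -> Prop :=
| RepRefl x : rep_eq x x
| RepSym x y : rep_eq x y -> rep_eq y x
| RepTrans x y z : rep_eq x y -> rep_eq y z -> rep_eq x z
| RepOpp x x' : rep_eq x x' -> rep_eq (ROpp x) (ROpp x')
| RepAdd x x' y y' : rep_eq x x' -> rep_eq y y' -> rep_eq (RAdd x y) (RAdd x' y')
| RepScale k x x' : rep_eq x x' -> rep_eq (RScale k x) (RScale k x')
| RepMul x x' y y' : rep_eq x x' -> rep_eq y y' -> rep_eq (RMul x y) (RMul x' y')
| RepAddA x y z : rep_eq (RAdd x (RAdd y z)) (RAdd (RAdd x y) z)
| RepAddC x y : rep_eq (RAdd x y) (RAdd y x)
| RepAdd0 x : rep_eq (RAdd RZero x) x
| RepAddN x : rep_eq (RAdd (ROpp x) x) RZero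
| RepScaleA k l x : rep_eq (RScale k (RScale l x)) (RScale (k * l) x)
| RepScale1 x : rep_eq (RScale 1 x) x
| RepScaleDr k x y : rep_eq (RScale k (RAdd x y)) (RAdd (RScale k x) (RScale k y))
| RepScaleDl k l x : rep_eq (RScale (k + l) x) (RAdd (RScale k x) (RScale l x))
| RepMulA x y z : rep_eq (RMul x (RMul y z)) (RMul (RMul x y) z)
| RepMulC x y : rep_eq (RMul x y) (RMul y x)
| RepMulDl x y z : rep_eq (RMul (RAdd x y) z) (RAdd (RMul x z) (RMul y z))
| RepMulZl k x y : rep_eq (RMul (RScale k x) y) (RScale k (RMul x y))
| RepGenDl k a b al :
    rep_eq (RGen (k *: a + b) al) (RAdd (RScale k (RGen a al)) (RGen b al))
| RepGenDr k a al be :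
    rep_eq (RGen a (k *: al + be)) (RAdd (RScale k (RGen a al)) (RGen a be))
| RepGenM a b al s :
    comul al = \sum_(p <- s) p.1 ⊗ p.2 ->
    rep_eq (RGen (a ∙ b) al) (rterm_sum s a b).

HB.instance Definition _ := gen_eqMixin rep_term.
HB.instance Definition _ := gen_choiceMixin rep_term.

Definition rep_eqb x y := `[< rep_eq x y >].

Lemma rep_eqb_refl : reflexive rep_eqb.
Proof. by move=> s; apply/asboolP; exact: RepRefl. Qed.

Lemma rep_eqb_sym : symmetric rep_eqb.
Proof. by move=> s t; apply/asboolP/asboolP; exact: RepSym. Qed.

Lemma rep_eqb_trans : transitive rep_eqb.
Proof.
by move=> t s u /asboolP st /asboolP tu; apply/asboolP; exact: RepTrans st tu.
Qed.

Canonical rep_equiv := EquivRel rep_eqb rep_eqb_refl rep_eqb_sym rep_eqb_trans.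

Definition rep_alg := {eq_quot rep_equiv}.

HB.instance Definition _ := Choice.on rep_alg.
HB.instance Definition _ := EqQuotient.on rep_alg.

Lemma rep_piP x y : \pi_rep_alg x = \pi_rep_alg y <-> rep_eq x y.
Proof. by split=> [/eqmodP/asboolP //|st]; apply/eqmodP/asboolP. Qed.

Lemma rep_repr x : rep_eq (repr (\pi_rep_alg x)) x.
Proof. by apply/rep_piP; rewrite reprK. Qed.

Definition rep_opp (x : rep_alg) : rep_alg := \pi_rep_alg (ROpp (repr x)).
Definition rep_add (x y : rep_alg) : rep_alg :=
  \pi_rep_alg (RAdd (repr x) (repr y)).
Definition rep_scale k (x : rep_alg) : rep_alg := \pi_rep_alg (RScale k (repr x)).
Definition rep_mul (x y : rep_alg) : rep_alg :=
  \pi_rep_alg (RMul (repr x) (repr y)).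

(* The symbol a_alpha *)
Definition symb (a : A) (al : M) : rep_alg := \pi_rep_alg (RGen a al).

Lemma rep_opp_pi x : rep_opp (\pi_rep_alg x) = \pi_rep_alg (ROpp x).
Proof. by apply/rep_piP/RepOpp/rep_repr. Qed.

Lemma rep_add_pi x y :
  rep_add (\pi_rep_alg x) (\pi_rep_alg y) = \pi_rep_alg (RAdd x y).
Proof. by apply/rep_piP/RepAdd; exact: rep_repr. Qed.

Lemma rep_scale_pi k x : rep_scale k (\pi_rep_alg x) = \pi_rep_alg (RScale k x).
Proof. by apply/rep_piP/RepScale/rep_repr. Qed.

Lemma rep_mul_pi x y :
  rep_mul (\pi_rep_alg x) (\pi_rep_alg y) = \pi_rep_alg (RMul x y).
Proof. by apply/rep_piP/RepMul; exact: rep_repr. Qed.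

Fact rep_addA : associative rep_add.
Proof.
elim/quotW=> x; elim/quotW=> y; elim/quotW=> z.
rewrite (rep_add_pi y z) (rep_add_pi x y) !rep_add_pi.
by apply/rep_piP; exact: RepAddA.
Qed.

Fact rep_addC : commutative rep_add.
Proof.
elim/quotW=> x; elim/quotW=> y; rewrite !rep_add_pi.
by apply/rep_piP; exact: RepAddC.
Qed.

Fact rep_add0 : left_id (\pi_rep_alg RZero) rep_add.
Proof.
by elim/quotW=> x; rewrite !rep_add_pi; apply/rep_piP; exact: RepAdd0.
Qed.

Fact rep_addN : left_inverse (\pi_rep_alg RZero) rep_opp rep_add.
Proof.
elim/quotW=> x; rewrite (rep_opp_pi x) !rep_add_pi.
by apply/rep_piP; exact: RepAddN.
Qed.

HB.instance Definition _ :=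
  GRing.isZmodule.Build rep_alg rep_addA rep_addC rep_add0 rep_addN.

Fact rep_scaleA k l x : rep_scale k (rep_scale l x) = rep_scale (k * l) x.
Proof.
elim/quotW: x => x; rewrite (rep_scale_pi l x) !rep_scale_pi.
by apply/rep_piP; exact: RepScaleA.
Qed.

Fact rep_scale1 : left_id 1 rep_scale.
Proof.
by elim/quotW=> x; rewrite rep_scale_pi; apply/rep_piP; exact: RepScale1.
Qed.

Fact rep_scaleDr : right_distributive rep_scale +%R.
Proof.
move=> k; elim/quotW=> x; elim/quotW=> y; rewrite /GRing.add /=.
rewrite (rep_scale_pi k x) (rep_scale_pi k y) (rep_add_pi x y).
by rewrite rep_scale_pi rep_add_pi; apply/rep_piP; exact: RepScaleDr.
Qed.

Fact rep_scaleDl x : {morph rep_scale^~ x : k l / k + l}.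
Proof.
move=> k l; elim/quotW: x => x; rewrite /(_ + _ : rep_alg) /=.
rewrite (rep_scale_pi k x) (rep_scale_pi l x) rep_scale_pi [RHS]rep_add_pi.
by apply/rep_piP; exact: RepScaleDl.
Qed.

HB.instance Definition _ := GRing.Zmodule_isLmodule.Build K rep_alg
  rep_scaleA rep_scale1 rep_scaleDr rep_scaleDl.

Fact rep_mulA : associative rep_mul.
Proof.
elim/quotW=> x; elim/quotW=> y; elim/quotW=> z.
rewrite (rep_mul_pi y z) (rep_mul_pi x y) !rep_mul_pi.
by apply/rep_piP; exact: RepMulA.
Qed.

Fact rep_mulC : commutative rep_mul.
Proof.
elim/quotW=> x; elim/quotW=> y; rewrite !rep_mul_pi.
by apply/rep_piP; exact: RepMulC.
Qed.

Fact rep_mul_bilinear : bilinear_map rep_mul.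
Proof.
have H y : linear (rep_mul^~ y).
  elim/quotW: y => z k; elim/quotW=> x; elim/quotW=> y.
  rewrite [_ *: \pi_rep_alg x]rep_scale_pi [X in rep_mul X]rep_add_pi.
  rewrite (rep_mul_pi x z) (rep_mul_pi y z) rep_mul_pi.
  rewrite [_ *: _]rep_scale_pi [RHS]rep_add_pi; apply/rep_piP.
  apply: RepTrans (RepMulDl _ _ _) _; apply: RepAdd; last exact: RepRefl.
  exact: RepMulZl.
by split=> // x k y z; rewrite !(rep_mulC x); exact: H.
Qed.

HB.instance Definition _ :=
  isAssocAlgebra.Build K rep_alg rep_mulA rep_mul_bilinear.
HB.instance Definition _ := isCommAlgebra.Build K rep_alg rep_mulC.

Lemma symb_bilinear : bilinear_map symb.
Proof.
split=> [al k a b|a k al be].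
  rewrite -[RHS]/(rep_add (rep_scale k _) _) rep_scale_pi rep_add_pi.
  by apply/rep_piP; exact: RepGenDl.
rewrite -[RHS]/(rep_add (rep_scale k _) _) rep_scale_pi rep_add_pi.
by apply/rep_piP; exact: RepGenDr.
Qed.

Lemma symbM a b al :
  symb (a ∙ b) al = tlift (fun al1 al2 => symb a al1 ∙ symb b al2) (comul al).
Proof.
have -> : symb (a ∙ b) al = \pi_rep_alg (rterm_sum (repr (comul al)) a b).
  by apply/rep_piP/RepGenM; exact: tens_sum.
rewrite /tlift; elim: (repr _) => [|p s IHs]; first by rewrite big_nil.
by rewrite big_cons /= -IHs [_ ∙ _]rep_mul_pi [RHS]rep_add_pi.
Qed.

Lemma rep_alg_ind (P : rep_alg -> Prop) :
  (forall a al, P (symb a al)) -> P 0 ->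
  (forall k x y, P x -> P y -> P (k *: x + y)) ->
  (forall x y, P x -> P y -> P (x ∙ y)) -> forall x, P x.
Proof.
move=> Pg P0 PD PM.
have PDx x y : P x -> P y -> P (x + y).
  by move=> Px Py; rewrite -[x]scale1r; exact: PD.
have PZ k x : P x -> P (k *: x) by move=> Px; rewrite -[_ *: _]addr0; exact: PD.
elim/quotW; elim.
- exact: Pg.
- exact: P0.
- by move=> x Px; rewrite -rep_opp_pi; have := PZ (-1) _ Px; rewrite scaleN1r.
- by move=> x Px y Py; rewrite -rep_add_pi; exact: PDx.
- by move=> k x Px; rewrite -rep_scale_pi; exact: PZ.
- by move=> x Px y Py; rewrite -rep_mul_pi; exact: PM.
Qed.

End Representation.


Section AlgebraTheory.
Variables (K : comPzRingType) (B : assocAlgType K).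
Implicit Types x y z : B.

Lemma amul_linearl y : linear (fun x : B => x ∙ y).
Proof. by case: (amul_bilinear (s := B)) => fl _; exact: fl. Qed.

Lemma amul_linearr x : linear (fun y : B => x ∙ y).
Proof. by case: (amul_bilinear (s := B)) => _ fr; exact: fr. Qed.

Lemma amulDl x y z : (x + y) ∙ z = x ∙ z + y ∙ z.
Proof. exact: linearED (amul_linearl z). Qed.

Lemma amulDr x y z : x ∙ (y + z) = x ∙ y + x ∙ z.
Proof. exact: linearED (amul_linearr x). Qed.

Lemma amulZl k x y : (k *: x) ∙ y = k *: (x ∙ y).
Proof. exact: linearEZ (amul_linearl y). Qed.

Lemma amulZr k x y : x ∙ (k *: y) = k *: (x ∙ y).
Proof. exact: linearEZ (amul_linearr x). Qed.

Lemma amul0l x : 0 ∙ x = 0.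
Proof. exact: linearE0 (amul_linearl x). Qed.

Lemma amul0r x : x ∙ 0 = 0.
Proof. exact: linearE0 (amul_linearr x). Qed.

Lemma amulNl x y : (- x) ∙ y = - (x ∙ y).
Proof. by rewrite -scaleN1r amulZl scaleN1r. Qed.

Lemma amulNr x y : x ∙ (- y) = - (x ∙ y).
Proof. by rewrite -scaleN1r amulZr scaleN1r. Qed.

Lemma amul_suml I (r : seq I) (F : I -> B) y :
  (\sum_(i <- r) F i) ∙ y = \sum_(i <- r) F i ∙ y.
Proof.
by elim: r => [|i r IHr]; rewrite ?big_nil ?amul0l // !big_cons amulDl IHr.
Qed.

Lemma amul_sumr I (r : seq I) (F : I -> B) y :
  y ∙ (\sum_(i <- r) F i) = \sum_(i <- r) y ∙ F i.
Proof.
by elim: r => [|i r IHr]; rewrite ?big_nil ?amul0r // !big_cons amulDr IHr.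
Qed.

End AlgebraTheory.

(* K e (+) B, with e = (1, 0) *)
Section Unitization.
Variables (K : comPzRingType) (B : comAssocAlgType K).

Definition unitization : Type := (K^o * B)%type.

HB.instance Definition _ := GRing.Lmodule.copy unitization (K^o * B)%type.

Definition unitz_inj (x : B) : unitization := (0, x).

Definition unitz_mul (x y : unitization) : unitization :=
  let k : K := x.1 in let l : K := y.1 in
  (k * l, k *: y.2 + l *: x.2 + x.2 ∙ y.2).

Fact unitz_mulC : commutative unitz_mul.
Proof.
by move=> x y; rewrite /unitz_mul mulrC [X in X + _]addrC amulC.
Qed.

Fact unitz_mulA : associative unitz_mul.
Proof.
move=> [k x] [l y] [m z]; rewrite /unitz_mul /= mulrA; congr (_, _).
rewrite !(scalerDr, amulDl, amulDr, amulZl, amulZr, scalerA) amulA.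
rewrite [m * k]mulrC [m * l]mulrC !addrA.
by rewrite [LHS](ACl (1*2*4*6*3*5*7)).
Qed.

Fact unitz_mul_bilinear : bilinear_map unitz_mul.
Proof.
have H y : linear (unitz_mul^~ y).
  case: y => [m z] k [l x] [l' y]; rewrite /unitz_mul /=.
  congr (_, _); first by rewrite /= mulrDl -mulrA.
  rewrite /= scalerDl amulDl amulZl !scalerDr !scalerA [m * k]mulrC !addrA.
  by rewrite [LHS](ACl (1*3*5*2*4*6)).
by split=> // x k y z; rewrite !(unitz_mulC x); exact: H.
Qed.

Fact unitz_mul1 : left_id ((1, 0) : unitization) unitz_mul.
Proof.
by move=> [k x]; rewrite /unitz_mul /= mul1r scale1r scaler0 addr0 amul0l addr0.
Qed.

Fact unitz_mul1r : right_id ((1, 0) : unitization) unitz_mul.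
Proof. by move=> x; rewrite unitz_mulC unitz_mul1. Qed.

HB.instance Definition _ :=
  isAssocAlgebra.Build K unitization unitz_mulA unitz_mul_bilinear.
HB.instance Definition _ := hasAlgUnit.Build K unitization unitz_mul1 unitz_mul1r.
HB.instance Definition _ := isCommAlgebra.Build K unitization unitz_mulC.

End Unitization.

(* The quotient of a commutative unital algebra by the ideal generated by S.   *)
Section QuotientAlgebra.
Variables (K : comPzRingType) (U : comUnitalAlgType K) (S : U -> Prop).

Inductive ideal_gen : U -> Prop :=
| IdealGen x : S x -> ideal_gen x
| Ideal0 : ideal_gen 0
| IdealAdd x y : ideal_gen x -> ideal_gen y -> ideal_gen (x + y)
| IdealMul u x : ideal_gen x -> ideal_gen (u ∙ x).

Lemma ideal_genZ k x : ideal_gen x -> ideal_gen (k *: x).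
Proof. by move=> Ix; rewrite -(amul1 x) -amulZl; exact: IdealMul. Qed.

Lemma ideal_genN x : ideal_gen x -> ideal_gen (- x).
Proof. by rewrite -scaleN1r; exact: ideal_genZ. Qed.

Definition ideal_eqb x y := `[< ideal_gen (x - y) >].

Lemma ideal_eqb_refl : reflexive ideal_eqb.
Proof. by move=> x; apply/asboolP; rewrite subrr; exact: Ideal0. Qed.

Lemma ideal_eqb_sym : symmetric ideal_eqb.
Proof. by move=> x y; apply/asboolP/asboolP => /ideal_genN; rewrite opprB. Qed.

Lemma ideal_eqb_trans : transitive ideal_eqb.
Proof.
move=> y x z /asboolP xy /asboolP yz; apply/asboolP.
by rewrite -(subrKA y); exact: IdealAdd.
Qed.

Canonical ideal_equiv :=
  EquivRel ideal_eqb ideal_eqb_refl ideal_eqb_sym ideal_eqb_trans.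

Definition quot_alg := {eq_quot ideal_equiv}.

HB.instance Definition _ := Choice.on quot_alg.
HB.instance Definition _ := EqQuotient.on quot_alg.

Definition qproj (x : U) : quot_alg := \pi_quot_alg x.

Lemma qprojP x y : qproj x = qproj y <-> ideal_gen (x - y).
Proof. by split=> [/eqmodP/asboolP //|st]; apply/eqmodP/asboolP. Qed.

Lemma qprojK (x : quot_alg) : qproj (repr x) = x.
Proof. exact: reprK. Qed.

Lemma qproj_ind (P : quot_alg -> Prop) : (forall x, P (qproj x)) -> forall x, P x.
Proof. by move=> Pq x; rewrite -(qprojK x). Qed.

Lemma qrepr x : ideal_gen (repr (qproj x) - x).
Proof. by apply/qprojP; rewrite qprojK. Qed.

Definition quot_opp (x : quot_alg) : quot_alg := qproj (- repr x).
Definition quot_add (x y : quot_alg) : quot_alg := qproj (repr x + repr y).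
Definition quot_scale k (x : quot_alg) : quot_alg := qproj (k *: repr x).
Definition quot_mul (x y : quot_alg) : quot_alg := qproj (repr x ∙ repr y).

Lemma quot_oppE x : quot_opp (qproj x) = qproj (- x).
Proof. by apply/qprojP; rewrite -opprD; exact/ideal_genN/qrepr. Qed.

Lemma quot_addE x y : quot_add (qproj x) (qproj y) = qproj (x + y).
Proof.
by apply/qprojP; rewrite opprD addrACA; apply: IdealAdd; exact: qrepr.
Qed.

Lemma quot_scaleE k x : quot_scale k (qproj x) = qproj (k *: x).
Proof. by apply/qprojP; rewrite -scalerBr; exact/ideal_genZ/qrepr. Qed.

Lemma quot_mulE x y : quot_mul (qproj x) (qproj y) = qproj (x ∙ y).
Proof.
apply/qprojP; set x' := repr _; set y' := repr _.
rewrite -(subrKA (x' ∙ y)) -amulNr -amulDr -amulNl -amulDl amulC.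
by apply: IdealAdd; rewrite amulC; apply: IdealMul; exact: qrepr.
Qed.

Fact quot_addA : associative quot_add.
Proof.
elim/qproj_ind=> x; elim/qproj_ind=> y; elim/qproj_ind=> z.
by rewrite (quot_addE y z) (quot_addE x y) !quot_addE addrA.
Qed.

Fact quot_addC : commutative quot_add.
Proof.
by elim/qproj_ind=> x; elim/qproj_ind=> y; rewrite !quot_addE addrC.
Qed.

Fact quot_add0 : left_id (qproj 0) quot_add.
Proof. by elim/qproj_ind=> x; rewrite quot_addE add0r. Qed.

Fact quot_addN : left_inverse (qproj 0) quot_opp quot_add.
Proof. by elim/qproj_ind=> x; rewrite (quot_oppE x) quot_addE addNr. Qed.

HB.instance Definition _ :=
  GRing.isZmodule.Build quot_alg quot_addA quot_addC quot_add0 quot_addN.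

Lemma qprojD x y : qproj (x + y) = qproj x + qproj y.
Proof. by rewrite -quot_addE. Qed.

Fact quot_scaleA k l x : quot_scale k (quot_scale l x) = quot_scale (k * l) x.
Proof.
by elim/qproj_ind: x => x; rewrite (quot_scaleE l) !quot_scaleE scalerA.
Qed.

Fact quot_scale1 : left_id 1 quot_scale.
Proof. by elim/qproj_ind=> x; rewrite quot_scaleE scale1r. Qed.

Fact quot_scaleDr : right_distributive quot_scale +%R.
Proof.
move=> k; elim/qproj_ind=> x; elim/qproj_ind=> y.
by rewrite -qprojD !quot_scaleE -qprojD scalerDr.
Qed.

Fact quot_scaleDl x : {morph quot_scale^~ x : k l / k + l}.
Proof.
by move=> k l; elim/qproj_ind: x => x; rewrite !quot_scaleE -qprojD scalerDl.
Qed.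

HB.instance Definition _ := GRing.Zmodule_isLmodule.Build K quot_alg
  quot_scaleA quot_scale1 quot_scaleDr quot_scaleDl.

Lemma qproj_linear : linear qproj.
Proof. by move=> k x y; rewrite qprojD -quot_scaleE. Qed.

Fact quot_mulA : associative quot_mul.
Proof.
elim/qproj_ind=> x; elim/qproj_ind=> y; elim/qproj_ind=> z.
by rewrite (quot_mulE y z) (quot_mulE x y) !quot_mulE amulA.
Qed.

Fact quot_mulC : commutative quot_mul.
Proof.
by elim/qproj_ind=> x; elim/qproj_ind=> y; rewrite !quot_mulE amulC.
Qed.

Fact quot_mul_bilinear : bilinear_map quot_mul.
Proof.
have H y : linear (quot_mul^~ y).
  elim/qproj_ind: y => z k; elim/qproj_ind=> x; elim/qproj_ind=> y.
  by rewrite -qproj_linear !quot_mulE -qproj_linear amul_linearl.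
by split=> // x k y z; rewrite !(quot_mulC x); exact: H.
Qed.

Fact quot_mul1 : left_id (qproj aone) quot_mul.
Proof. by elim/qproj_ind=> x; rewrite quot_mulE amul1. Qed.

Fact quot_mul1r : right_id (qproj aone) quot_mul.
Proof. by move=> x; rewrite quot_mulC quot_mul1. Qed.

HB.instance Definition _ :=
  isAssocAlgebra.Build K quot_alg quot_mulA quot_mul_bilinear.
HB.instance Definition _ := hasAlgUnit.Build K quot_alg quot_mul1 quot_mul1r.
HB.instance Definition _ := isCommAlgebra.Build K quot_alg quot_mulC.

Lemma qprojM x y : qproj (x ∙ y) = qproj x ∙ qproj y.
Proof. by rewrite -quot_mulE. Qed.

End QuotientAlgebra.

(* A_M^+ *)
Section UnitalRepresentation.
Variables (K : comPzRingType) (A : unitalAlgType K) (M : coalgType K).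

Definition unit_relator (x : unitization (rep_alg A M)) : Prop :=
  exists al : M, x = unitz_inj (symb aone al) - counit al *: aone.

Definition rep_alg_plus := quot_alg unit_relator.

HB.instance Definition _ := ComUnitalAlgebra.on rep_alg_plus.

(* The canonical projection K e (+) A_M -> A_M^+ and the classes of a_alpha.   *)
Definition rep_proj (x : unitization (rep_alg A M)) : rep_alg_plus := qproj _ x.
Definition symb_plus (a : A) (al : M) : rep_alg_plus :=
  rep_proj (unitz_inj (symb a al)).

End UnitalRepresentation.


Section LinearityRules.
Variable K : comPzRingType.
Implicit Types U V W P Q : lmodType K.

Lemma lin_id U : linear (fun x : U => x). Proof. by []. Qed.

Lemma lin_comp U V W (f : V -> W) (g : U -> V) :
  linear f -> linear g -> linear (fun x => f (g x)).
Proof. by move=> lf lg k x y; rewrite lg lf. Qed.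

Lemma lin_add U V (f g : U -> V) :
  linear f -> linear g -> linear (fun x => f x + g x).
Proof. by move=> lf lg k x y; rewrite lf lg scalerDr addrACA. Qed.

Lemma lin_opp U V (f : U -> V) : linear f -> linear (fun x => - f x).
Proof. by move=> lf k x y; rewrite lf opprD scalerN. Qed.

Lemma lin_scale U V (f : U -> V) (l : K) :
  linear f -> linear (fun x => l *: f x).
Proof. by move=> lf k x y; rewrite lf scalerDr !scalerA mulrC. Qed.

Lemma lin_scalel U V (f : U -> K) (v : V) :
  linear (f : U -> K^o) -> linear (fun x => f x *: v).
Proof.
move=> lf k x y; have -> : f (k *: x + y) = k * f x + f y by exact: lf.
by rewrite scalerDl scalerA.
Qed.

Lemma lin_mull U (B : assocAlgType K) (f : U -> B) y :
  linear f -> linear (fun x => f x ∙ y).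
Proof. by move=> lf; exact: lin_comp (amul_linearl y) lf. Qed.

Lemma lin_mulr U (B : assocAlgType K) (f : U -> B) y :
  linear f -> linear (fun x => y ∙ f x).
Proof. by move=> lf; exact: lin_comp (amul_linearr y) lf. Qed.

Lemma lin_tlift U V W P (F : U -> V -> W -> P) (t : (V ⊗ W)%type) :
  (forall a b, linear (fun x => F x a b)) -> linear (fun x => tlift (F x) t).
Proof.
move=> lF k x y; rewrite /tlift scaler_sumr -big_split.
by apply: eq_bigr => p _; exact: lF.
Qed.

Lemma lin_tliftr U V W P (F : V -> W -> P) (f : U -> (V ⊗ W)%type) :
  bilinear_map F -> linear f -> linear (fun x => tlift F (f x)).
Proof. by move=> bF; exact: lin_comp (tlift_linear bF). Qed.

Lemma lin_purel U V W (f : U -> V) (y : W) :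
  linear f -> linear (fun x => f x ⊗ y).
Proof. by move=> lf; exact: lin_comp ((pure_bilinear V W).1 y) lf. Qed.

Lemma lin_purer U V W (f : U -> V) (y : W) :
  linear f -> linear (fun x => y ⊗ f x).
Proof. by move=> lf; exact: lin_comp ((pure_bilinear W V).2 y) lf. Qed.

Lemma lin_symbl (A : assocAlgType K) (M : coalgType K) U (f : U -> A) (al : M) :
  linear f -> linear (fun x => symb (f x) al).
Proof. by move=> lf; exact: lin_comp ((symb_bilinear A M).1 al) lf. Qed.

Lemma lin_symbr (A : assocAlgType K) (M : coalgType K) U (f : U -> M) (a : A) :
  linear f -> linear (fun x => symb a (f x)).
Proof. by move=> lf; exact: lin_comp ((symb_bilinear A M).2 a) lf. Qed.

Lemma lin_comul (M : coalgType K) U (f : U -> M) :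
  linear f -> linear (fun x => comul (f x)).
Proof. by move=> lf; exact: lin_comp comul_linear lf. Qed.

Lemma lin_sum U V (f : U -> V) I (r : seq I) (F : I -> U) :
  linear f -> f (\sum_(i <- r) F i) = \sum_(i <- r) f (F i).
Proof.
move=> lf; elim: r => [|i r IHr]; first by rewrite !big_nil linearE0.
by rewrite !big_cons linearED // IHr.
Qed.

Lemma tlift_lin U V W P (F : V -> W -> U) (f : U -> P) t :
  linear f -> f (tlift F t) = tlift (fun x y => f (F x y)) t.
Proof. by move=> lf; rewrite /tlift lin_sum. Qed.

Lemma eq_tlift U V P (F G : U -> V -> P) t :
  (forall x y, F x y = G x y) -> tlift F t = tlift G t.
Proof. by move=> FG; apply: eq_bigr => p _; exact: FG. Qed.

Lemma tliftD U V P (F G : U -> V -> P) t :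
  tlift (fun x y => F x y + G x y) t = tlift F t + tlift G t.
Proof. exact: big_split. Qed.

Lemma tliftN U V P (F : U -> V -> P) t :
  tlift (fun x y => - F x y) t = - tlift F t.
Proof. by rewrite /tlift sumrN. Qed.

Lemma tlift_swap U V U' V' P (F : U -> V -> U' -> V' -> P) t t' :
  tlift (fun x y => tlift (F x y) t') t =
  tlift (fun x' y' => tlift (fun x y => F x y x' y') t) t'.
Proof. exact: exchange_big. Qed.

Lemma tlift_tmap U V U' V' P (F : U' -> V' -> P) (f : U -> U') (g : V -> V') t :
  bilinear_map F -> linear f -> linear g ->
  tlift F (tmap f g t) = tlift (fun x y => F (f x) (g y)) t.
Proof.
move=> bF lf lg; have [Fl Fr] := bF.
have bp : bilinear_map (fun x y => f x ⊗ g y).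
  by split=> [y|x]; [exact: lin_purel|exact: lin_purer].
have bFc : bilinear_map (fun x y => F (f x) (g y)).
  split=> [y|x]; first exact: (lin_comp (f := F^~ (g y))).
  exact: (lin_comp (f := F (f x))).
move: t; apply: eq_tens_linear => [||x y].
- exact: lin_tliftr (tlift_linear bp).
- exact: tlift_linear.
- by rewrite /tmap tlift_pure // tlift_pure // tlift_pure.
Qed.

End LinearityRules.

Ltac lin := repeat first
  [ assumption | exact: lin_id | apply: lin_add | apply: lin_opp
  | apply: lin_scale | apply: lin_mull | apply: lin_mulr
  | apply: lin_purel | apply: lin_purer | apply: lin_symbl | apply: lin_symbr
  | apply: lin_tlift => ? ? | apply: lin_comul ].

Ltac bilin := split=> ? /=; lin.

Section Sweedler.
Variables (K : comPzRingType) (M : coalgType K) (P : lmodType K).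
Variable f : M -> M -> M -> P.
Hypotheses (f1 : forall y z, linear (fun x => f x y z))
           (f2 : forall x z, linear (fun y => f x y z))
           (f3 : forall x y, linear (fun z => f x y z)).

Let bf12 z : bilinear_map (fun x y => f x y z).
Proof. by split=> ?. Qed.

Let bf23 x : bilinear_map (f x).
Proof. by split=> ?; [exact: f2|exact: f3]. Qed.

Lemma comul3l x : tlift3 f (comul3 x) =
  tlift (fun y z => tlift (fun y1 y2 => f y1 y2 z) (comul y)) (comul x).
Proof.
rewrite /tlift3 /comul3 tlift_tmap //; last exact: comul_linear.
by split=> u; [exact: tlift_linear (bf12 u)|apply: lin_tlift => ? ?; exact: f3].
Qed.

Lemma comul3r x : tlift3 f (comul3 x) =
  tlift (fun y z => tlift (f y) (comul z)) (comul x).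
Proof.
have bl : bilinear_map (fun u z => tlift (fun x y => f x y z) u).
  by split=> u; [exact: tlift_linear (bf12 u)|apply: lin_tlift => ? ?; exact: f3].
have br : bilinear_map (fun x w => tlift (f x) w).
  by split=> u; [apply: lin_tlift => ? ?; exact: f1|exact: tlift_linear (bf23 u)].
have bp : bilinear_map (fun (u : (M ⊗ M)%type) (z : M) =>
    tlift (fun x y => x ⊗ (y ⊗ z)) u).
  split=> u; first by apply: tlift_linear; bilin.
  by lin.
have H t : tlift (fun x w => tlift (f x) w) (tassoc t) = tlift3 f t.
  move: t; apply: eq_tens_linear.
  - by apply: lin_tliftr => //; exact: tlift_linear.
  - exact: tlift_linear.
  move=> u z; move: u; apply: eq_tens_linear.
  - by apply: lin_tliftr => //; apply: lin_comp (tlift_linear bp) _; lin.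
  - by apply: lin_comp (tlift_linear bl) _; lin.
  move=> x' y'; rewrite /tassoc /tlift3 (tlift_pure bp) (tlift_pure bl).
  rewrite tlift_pure; last by bilin.
  by rewrite (tlift_pure br) (tlift_pure (bf23 _)) (tlift_pure (bf12 _)).
rewrite -H /comul3 comulA tlift_tmap //; exact: comul_linear.
Qed.

Lemma coassocE x :
  tlift (fun y z => tlift (fun y1 y2 => f y1 y2 z) (comul y)) (comul x) =
  tlift (fun y z => tlift (f y) (comul z)) (comul x).
Proof. by rewrite -comul3l comul3r. Qed.

End Sweedler.

Section Brackets.
Variables (K : comPzRingType) (B : assocAlgType K).

Definition derivation (D : B -> B) : Prop :=
  linear D /\ (forall x y, D (x ∙ y) = D x ∙ y + x ∙ D y).

Definition biderivation (br : B -> B -> B) : Prop :=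
  (forall x, derivation (br x)) /\ (forall y, derivation (br^~ y)).

Definition antisymmetric_bracket (br : B -> B -> B) : Prop :=
  forall x y, br y x = - br x y.

Definition jacobi (br : B -> B -> B) : Prop :=
  forall x y z, br x (br y z) + br y (br z x) + br z (br x y) = 0.

End Brackets.

Definition Poisson_bracket (K : comPzRingType) (B : comAssocAlgType K)
    (br : B -> B -> B) : Prop :=
  [/\ biderivation br, antisymmetric_bracket br & jacobi br].

Section RepDerivation.
Variables (K : comPzRingType) (A : assocAlgType K) (M : coalgType K).
Local Notation R := (rep_alg A M).

Lemma rep_derivation (g : A -> M -> R) :
  bilinear_map g ->
  (forall a b al, g (a ∙ b) al =
     tlift (fun x y => g a x ∙ symb b y + symb a x ∙ g b y) (comul al)) ->
  exists D : R -> R, derivation D /\ forall a al, D (symb a al) = g a al.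
Proof.
move=> [gl gr] gM.
pose fix ev (t : rep_term A M) : R := match t with
  | RGen a al => g a al
  | RZero => 0
  | ROpp x => - ev x
  | RAdd x y => ev x + ev y
  | RScale k x => k *: ev x
  | RMul x y => ev x ∙ (\pi_R y) + (\pi_R x) ∙ ev y
  end.
have piS x y : rep_eq x y -> \pi_R x = \pi_R y by move=> /rep_piP.
have piA x y : \pi_R (RAdd x y) = \pi_R x + \pi_R y by rewrite -rep_add_pi.
have piZ k x : \pi_R (RScale k x) = k *: \pi_R x by rewrite -rep_scale_pi.
have piM x y : \pi_R (RMul x y) = \pi_R x ∙ \pi_R y by rewrite -rep_mul_pi.
have evP x y : rep_eq x y -> ev x = ev y.
  elim=> {x y} /=.
  - by [].
  - by [].
  - by move=> x y z _ -> _ ->.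
  - by move=> x y _ ->.
  - by move=> x x' y y' _ -> _ ->.
  - by move=> k x y _ ->.
  - by move=> x x' y y' /piS -> -> /piS -> ->.
  - by move=> *; rewrite addrA.
  - by move=> *; rewrite addrC.
  - by move=> *; rewrite add0r.
  - by move=> *; rewrite addNr.
  - by move=> *; rewrite scalerA.
  - by move=> *; rewrite scale1r.
  - by move=> *; rewrite scalerDr.
  - by move=> *; rewrite scalerDl.
  - by move=> x y z; rewrite !piM !(amulDl, amulDr) !amulA addrA.
  - by move=> x y; rewrite addrC; congr (_ + _); rewrite amulC.
  - by move=> x y z; rewrite piA !amulDl addrACA.
  - by move=> k x y; rewrite piZ !amulZl scalerDr.
  - by move=> k a b al; exact: gl.
  - by move=> k a al be; exact: gr.
  - move=> a b al s dal; rewrite gM dal -pi_sum tlift_pi; last by bilin.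
    elim: s {dal} => [|p s IHs] /=; first by rewrite big_nil.
    by rewrite big_cons IHs.
pose D (x : R) : R := ev (repr x).
have DE t : D (\pi_R t) = ev t by apply: evP; exact: rep_repr.
exists D; split; last by move=> a al; rewrite DE.
split=> [k|].
  elim/quotW=> x; elim/quotW=> y.
  by rewrite -piZ -piA !DE.
by elim/quotW=> x; elim/quotW=> y; rewrite -piM !DE.
Qed.

Lemma derivation_eq0 (D : R -> R) :
  derivation D -> (forall a al, D (symb a al) = 0) -> forall x, D x = 0.
Proof.
move=> [lD mD] D0; elim/rep_alg_ind=> //.
- exact: linearE0.
- by move=> k x y Dx Dy; rewrite lD Dx Dy scaler0 addr0.
- by move=> x y Dx Dy; rewrite mD Dx Dy amul0l amul0r addr0.
Qed.

End RepDerivation.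

Section RepBracket.
Variables (K : comPzRingType) (A : assocAlgType K) (M : coalgType K).
Variables (d : double_bracket A) (v : cyclic_form M).
Local Notation R := (rep_alg A M).

(* v(alpha (x) beta^2) x'_(beta^1) x''_(beta^3) for x in A (x) A *)
Definition symb_form (al be : M) (x : (A ⊗ A)%type) : R :=
  tlift3 (fun b1 b2 b3 : M =>
    v (al ⊗ b2) *: tlift (fun x' x'' => symb x' b1 ∙ symb x'' b3) x) (comul3 be).

Definition rep_bracket_spec (br : R -> R -> R) : Prop :=
  [/\ biderivation br, antisymmetric_bracket br &
      forall a b al be, br (symb a al) (symb b be) = symb_form al be (d (a ⊗ b))].

Lemma symbsym_bilinear (b1 b3 : M) :
  bilinear_map (fun x' x'' : A => symb x' b1 ∙ symb x'' b3).
Proof. by bilin. Qed.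

Lemma lin_form (U : lmodType K) (f : U -> (M ⊗ M)%type) (y : R) :
  linear f -> linear (fun x : U => v (f x) *: y).
Proof. by move=> lf; apply: lin_scalel; exact: lin_comp (@cform_linear _ _ v) lf. Qed.

Lemma symb_form_linear al be : linear (symb_form al be).
Proof.
apply: lin_tlift => u z; apply: lin_tlift => x y.
by apply: lin_scale; apply: tlift_linear; exact: symbsym_bilinear.
Qed.

Lemma symb_form_linearl be x : linear (fun al => symb_form al be x).
Proof.
by apply: lin_tlift => u z; apply: lin_tlift => p q; apply: lin_form; lin.
Qed.

Lemma symb_form_linearr al x : linear (fun be => symb_form al be x).
Proof.
apply: lin_tliftr.
  split=> z; last by lin.
  apply: tlift_linear; split=> w; [by lin|by apply: lin_form; lin].
apply: lin_tliftr; last by lin.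
by split=> ?; lin.
Qed.

Lemma symb_form_pure al be x' x'' : symb_form al be (x' ⊗ x'') =
  tlift3 (fun b1 b2 b3 : M => v (al ⊗ b2) *: (symb x' b1 ∙ symb x'' b3))
    (comul3 be).
Proof.
apply: eq_tlift => u z; apply: eq_tlift => x y.
by rewrite (tlift_pure (symbsym_bilinear _ _)).
Qed.

Lemma outerr_linear (c : A) : linear (@outerr _ A ^~ c).
Proof. by apply: tlift_linear; bilin. Qed.

Lemma outerl_linear (c : A) : linear (outerl c).
Proof. by apply: tlift_linear; bilin. Qed.

Lemma symb_form_outerr al be x c : symb_form al be (outerr x c) =
  tlift (fun p q => symb_form al p x ∙ symb c q) (comul be).
Proof.
move: x; apply: eq_tens_linear.
- exact: lin_comp (symb_form_linear _ _) (outerr_linear _).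
- by apply: lin_tlift => p q; apply: lin_mull; exact: symb_form_linear.
move=> x y; rewrite /outerr tlift_pure; last by bilin.
rewrite symb_form_pure.
pose f p1 p2 p3 q : R := v (al ⊗ p2) *: (symb x p1 ∙ symb y p3 ∙ symb c q).
have f1 p2 p3 q : linear (fun p1 => f p1 p2 p3 q) by rewrite /f; lin.
have f2 p1 p3 q : linear (fun p2 => f p1 p2 p3 q) by apply: lin_form; lin.
have f3 p1 p2 q : linear (fun p3 => f p1 p2 p3 q) by rewrite /f; lin.
have f4 p1 p2 p3 : linear (fun q => f p1 p2 p3 q) by rewrite /f; lin.
transitivity (tlift3 (fun b1 b2 b3 => tlift (f b1 b2) (comul b3)) (comul3 be)).
  apply: eq_tlift => u z; apply: eq_tlift => b1 b2; rewrite symbM.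
  rewrite (tlift_lin _ _ (amul_linearr _)) tlift_lin; last by lin.
  by apply: eq_tlift => p q; rewrite amulA.
rewrite comul3l; first last.
- by move=> *; apply: lin_tliftr; [split=> ?|]; lin.
- by move=> *; lin.
- by move=> *; lin.
transitivity (tlift (fun y0 z => tlift
   (fun w q => tlift (fun y1 y2 => f y1 y2 w q) (comul y0)) (comul z)) (comul be)).
  by apply: eq_tlift => p q; rewrite tlift_swap.
rewrite -(@coassocE _ _ _ (fun u w q => tlift (fun y1 y2 => f y1 y2 w q) (comul u)));
  first last.
- by move=> *; lin.
- by move=> *; lin.
- by move=> *; apply: lin_tliftr; [split=> ?|]; lin.
apply: eq_tlift => p q; rewrite symb_form_pure comul3l; first last.
- by move=> *; lin.
- by move=> *; apply: lin_form; lin.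
- by move=> *; lin.
rewrite (tlift_lin _ _ (amul_linearl _)); apply: eq_tlift => p1 p2.
rewrite (tlift_lin _ _ (amul_linearl _)); apply: eq_tlift => u1 u2.
by rewrite amulZl.
Qed.

Lemma symb_form_outerl al be x c : symb_form al be (outerl c x) =
  tlift (fun p q => symb c p ∙ symb_form al q x) (comul be).
Proof.
move: x; apply: eq_tens_linear.
- exact: lin_comp (symb_form_linear _ _) (outerl_linear _).
- by apply: lin_tlift => p q; apply: lin_mulr; exact: symb_form_linear.
move=> x y; rewrite /outerl tlift_pure; last by bilin.
rewrite symb_form_pure.
pose f p p1 p2 p3 : R := v (al ⊗ p2) *: (symb c p ∙ symb x p1 ∙ symb y p3).
have f1 p1 p2 p3 : linear (fun p => f p p1 p2 p3) by rewrite /f; lin.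
have f2 p p2 p3 : linear (fun p1 => f p p1 p2 p3) by rewrite /f; lin.
have f3 p p1 p3 : linear (fun p2 => f p p1 p2 p3) by apply: lin_form; lin.
have f4 p p1 p2 : linear (fun p3 => f p p1 p2 p3) by rewrite /f; lin.
transitivity (tlift3 (fun b1 b2 b3 =>
    tlift (fun p q => f p q b2 b3) (comul b1)) (comul3 be)).
  apply: eq_tlift => u z; apply: eq_tlift => b1 b2; rewrite symbM.
  by rewrite (tlift_lin _ _ (amul_linearl _)) tlift_lin; last by lin.
rewrite comul3r; first last.
- by move=> *; lin.
- by move=> *; lin.
- by move=> *; apply: lin_tliftr; [split=> ?|]; lin.
transitivity (tlift (fun y0 z => tlift
   (fun p q => tlift (fun b2 b3 => f p q b2 b3) (comul z)) (comul y0)) (comul be)).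
  by apply: eq_tlift => p q; rewrite tlift_swap.
rewrite (@coassocE _ _ _ (fun p q z => tlift (fun b2 b3 => f p q b2 b3) (comul z)));
  first last.
- by move=> *; apply: lin_tliftr; [split=> ?|]; lin.
- by move=> *; lin.
- by move=> *; lin.
apply: eq_tlift => p q; rewrite symb_form_pure comul3r; first last.
- by move=> *; lin.
- by move=> *; apply: lin_form; lin.
- by move=> *; lin.
rewrite (tlift_lin _ _ (amul_linearr _)); apply: eq_tlift => p1 p2.
rewrite (tlift_lin _ _ (amul_linearr _)); apply: eq_tlift => u1 u2.
by rewrite amulZr amulA.
Qed.

Lemma symb_form_flip al be x : symb_form be al (tflip x) = symb_form al be x.
Proof.
have bfl (U V : lmodType K) : bilinear_map (fun (x : U) (y : V) => y ⊗ x).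
  by bilin.
move: x; apply: eq_tens_linear.
- exact: lin_comp (symb_form_linear _ _) (tlift_linear (bfl _ _)).
- exact: symb_form_linear.
move=> x y; rewrite /tflip tlift_pure // !symb_form_pure.
have bm (a b : A) : bilinear_map (fun p q : M => symb a p ∙ symb b q) by bilin.
have hatE (a b : A) p q : tlift (fun p q : M => symb a p ∙ symb b q)
    (form_hat v (p ⊗ q)) =
    tlift3 (fun b1 b2 b3 : M => v (p ⊗ b2) *: (symb a b1 ∙ symb b b3)) (comul3 q).
  have L := tlift_linear (bm a b).
  rewrite /form_hat tlift_pure; last first.
    split=> w.
      apply: lin_tlift => u z; apply: lin_tlift => p1 p2; apply: lin_scalel.
      by apply: lin_comp (@cform_linear _ _ v) _; lin.
    apply: lin_tliftr.
      split=> z; last by lin.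
      apply: tlift_linear; split=> u; [by lin|apply: lin_scalel].
      by apply: lin_comp (@cform_linear _ _ v) _; lin.
    apply: lin_tliftr; last by lin.
    by split=> ?; lin.
  rewrite (tlift_lin _ _ L); apply: eq_tlift => u z.
  rewrite (tlift_lin _ _ L); apply: eq_tlift => p1 p2.
  by rewrite (linearEZ _ _ L) (tlift_pure (bm a b)).
rewrite -!hatE.
have -> : be ⊗ al = tflip (al ⊗ be) by rewrite /tflip tlift_pure.
rewrite cform_cyclic; set t := form_hat v _; move: t; apply: eq_tens_linear.
- by apply: lin_tliftr; [bilin|exact: tlift_linear].
- exact: tlift_linear.
by move=> p q; rewrite /tflip !tlift_pure // amulC.
Qed.

Lemma rep_bracket_exists : exists br, rep_bracket_spec br.
Proof.
pose g al be a b := symb_form al be (d (a ⊗ b)).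
have gN al be a b : g be al b a = - g al be a b.
  rewrite /g dbr_skew (_ : - tflip _ = (-1) *: tflip (d (a ⊗ b))).
    by rewrite (linearEZ _ _ (symb_form_linear _ _)) symb_form_flip scaleN1r.
  by rewrite scaleN1r.
have gb al be : bilinear_map (fun a b => g al be a b).
  have ls := symb_form_linear al be; have ld := dbr_linear d.
  split=> z.
    exact: lin_comp ls (lin_comp ld (lin_purel z (@lin_id _ A))).
  exact: lin_comp ls (lin_comp ld (lin_purer z (@lin_id _ A))).
have /choice [D0 HD0] : forall p : A * M, exists D : R -> R,
    derivation D /\ forall b be, D (symb b be) = g p.2 be p.1 b.
  move=> [a al]; apply: rep_derivation => /=.
    by split=> z; [case: (gb al z) => _; exact|exact: symb_form_linearr].
  move=> b c be; rewrite /g dbr_leibr linearED; last exact: symb_form_linear.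
  by rewrite symb_form_outerr symb_form_outerl -tliftD.
pose D a al := D0 (a, al).
have lD a al : linear (D a al) := (HD0 (a, al)).1.1.
have mD a al x y : D a al (x ∙ y) = D a al x ∙ y + x ∙ D a al y.
  exact: (HD0 (a, al)).1.2.
have DE a al b be : D a al (symb b be) = g al be a b := (HD0 (a, al)).2 b be.
have bD y : bilinear_map (fun a al => D a al y).
  elim/rep_alg_ind: y.
  - move=> b be; split=> z k x y; rewrite !DE; last exact: symb_form_linearl.
    by case: (gb z be) => H _; exact: H.
  - by split=> z k x y; rewrite !(linearE0 (lD _ _)) scaler0 addr0.
  - move=> l x y [xl xr] [yl yr]; split=> z k u w; rewrite !lD.
      by rewrite (xl z) (yl z) !scalerDr !scalerA mulrC addrACA.
    by rewrite (xr z) (yr z) !scalerDr !scalerA mulrC addrACA.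
  - move=> x y [xl xr] [yl yr]; split=> z k u w; rewrite !mD.
      by rewrite (xl z) (yl z) amulDl amulDr amulZl amulZr scalerDr addrACA.
    by rewrite (xr z) (yr z) amulDl amulDr amulZl amulZr scalerDr addrACA.
have pD y a b al : D (a ∙ b) al y =
    tlift (fun p q => D a p y ∙ symb b q + symb a p ∙ D b q y) (comul al).
  move: a b al; elim/rep_alg_ind: y.
  - move=> c ga a b al; rewrite DE gN -DE symbM (tlift_lin _ _ (lD c ga)).
    rewrite -tliftN; apply: eq_tlift => p q; rewrite mD !DE.
    by rewrite (gN ga) (gN ga q) amulNl amulNr opprD.
  - move=> a b al; rewrite (linearE0 (lD _ _)) /tlift big1 // => p _.
    by rewrite !(linearE0 (lD _ _)) amul0l amul0r addr0.
  - move=> k x y Hx Hy a b al; rewrite lD Hx Hy (tlift_lin _ _ (lin_scale k (@lin_id _ R))).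
    rewrite -tliftD; apply: eq_tlift => p q; rewrite !lD.
    by rewrite amulDl amulDr amulZl amulZr scalerDr addrACA.
  - move=> x y Hx Hy a b al; rewrite mD Hx Hy.
    rewrite (tlift_lin _ _ (amul_linearl y)) (tlift_lin _ _ (amul_linearr x)).
    rewrite -tliftD; apply: eq_tlift => p q; rewrite !mD !(amulDl, amulDr) !amulA.
    rewrite !addrA [LHS](ACl (1*3*2*4)); congr (_ + _ + _ + _).
      by rewrite -amulA [symb b q ∙ y]amulC amulA.
    by rewrite [x ∙ _]amulC.
have /choice [E HE] : forall y : R, exists E : R -> R,
    derivation E /\ forall a al, E (symb a al) = D a al y.
  by move=> y; exact: rep_derivation.
have lE y : linear (E y) := (HE y).1.1.
have mE y x z : E y (x ∙ z) = E y x ∙ z + x ∙ E y z := (HE y).1.2 x z.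
have EE y a al : E y (symb a al) = D a al y := (HE y).2 a al.
have lE' x : linear (E^~ x).
  elim/rep_alg_ind: x.
  - by move=> a al k x y; rewrite !EE lD.
  - by move=> k x y; rewrite !(linearE0 (lE _)) scaler0 addr0.
  - move=> l x y Hx Hy k u w; rewrite !lE Hx Hy !scalerDr !scalerA mulrC.
    by rewrite addrACA.
  - move=> x y Hx Hy k u w; rewrite !mE Hx Hy amulDl amulDr amulZl amulZr.
    by rewrite scalerDr addrACA.
have mE' x y z : E (y ∙ z) x = E y x ∙ z + y ∙ E z x.
  elim/rep_alg_ind: x.
  - by move=> a al; rewrite !EE mD.
  - by rewrite !(linearE0 (lE _)) amul0l amul0r addr0.
  - move=> l x w Hx Hw; rewrite !lE Hx Hw !amulDl !amulDr amulZl amulZr.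
    by rewrite scalerDr addrACA.
  - move=> x w Hx Hw; rewrite !mE Hx Hw !(amulDl, amulDr) !amulA.
    rewrite !addrA [LHS](ACl (1*3*2*4)); congr (_ + _ + _ + _).
      by rewrite -!amulA [z ∙ w]amulC.
    by rewrite [x ∙ y]amulC.
exists (fun x y => E y x); split; last by move=> a b al be; rewrite EE DE.
  by split=> x; split=> //; move=> *; exact: mE'.
move=> x y; move: y; elim/rep_alg_ind: x.
- move=> a al; elim/rep_alg_ind.
  + by move=> b be; rewrite !EE !DE.
  + by rewrite (linearE0 (lE _)) (linearE0 (lE' _)) oppr0.
  + by move=> k x y Hx Hy; rewrite lE lE' Hx Hy opprD scalerN.
  + by move=> x y Hx Hy; rewrite mE mE' Hx Hy amulNl amulNr opprD.
- by move=> y; rewrite (linearE0 (lE _)) (linearE0 (lE' _)) oppr0.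
- by move=> k x y Hx Hy z; rewrite lE lE' Hx Hy opprD scalerN.
- by move=> x y Hx Hy z; rewrite mE mE' Hx Hy amulNl amulNr opprD.
Qed.

Lemma rep_bracket_unique br br' :
  rep_bracket_spec br -> rep_bracket_spec br' -> forall x y, br x y = br' x y.
Proof.
move=> [[dr dl] _ brE] [[dr' dl'] _ brE'] x y; move: x; elim/rep_alg_ind.
- move=> a al; have [l m] := dr (symb a al); have [l' m'] := dr' (symb a al).
  elim/rep_alg_ind: y => [b be||k x y Hx Hy|x y Hx Hy].
  + by rewrite brE brE'.
  + by rewrite !linearE0.
  + by rewrite l l' Hx Hy.
  + by rewrite m m' Hx Hy.
- by rewrite (linearE0 (dl y).1) (linearE0 (dl' y).1).
- by move=> k x z Hx Hz; rewrite ((dl y).1 k x z) ((dl' y).1 k x z) /= Hx Hz.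
- by move=> x z Hx Hz; rewrite ((dl y).2 x z) ((dl' y).2 x z) /= Hx Hz.
Qed.

(* {-,-}_v *)
Definition rep_bracket : R -> R -> R := sval (cid rep_bracket_exists).

Lemma rep_bracketP : rep_bracket_spec rep_bracket.
Proof. exact: svalP. Qed.

End RepBracket.


Section PlusTheory.
Variables (K : comPzRingType) (A : unitalAlgType K) (M : coalgType K).
Local Notation R := (rep_alg A M).
Local Notation RU := (unitization (rep_alg A M)).
Local Notation RP := (rep_alg_plus A M).
Local Notation I := (ideal_gen (@unit_relator K A M)).

Lemma unitz_inj_linear : linear (@unitz_inj K R).
Proof.
by move=> k x y; congr (_, _); rewrite /= ?scaler0 ?addr0.
Qed.

Lemma snd_linear : linear (fun x : RU => x.2).
Proof. by []. Qed.

Lemma unitz_inj2 (x : RU) y : unitz_inj (x.2 ∙ y + (x.1 : K) *: y) = x ∙ unitz_inj y.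
Proof.
by congr (_, _); rewrite /= ?mulr0 // scale0r addr0 addrC.
Qed.

Lemma rep_proj_ind (P : RP -> Prop) : (forall x, P (rep_proj x)) -> forall x, P x.
Proof. exact: qproj_ind. Qed.

Lemma rep_proj_linear : linear (@rep_proj K A M).
Proof. exact: qproj_linear. Qed.

Lemma rep_projM (x y : RU) : rep_proj (x ∙ y) = rep_proj x ∙ rep_proj y.
Proof. exact: qprojM. Qed.

Lemma derivation_unitz (D : R -> R) : derivation D ->
  derivation (fun x : RU => unitz_inj (D x.2)).
Proof.
move=> [lD mD]; split=> [k x y|x y]; first by rewrite /= lD unitz_inj_linear.
rewrite (_ : (x ∙ y).2 = (x.1 : K) *: y.2 + (y.1 : K) *: x.2 + x.2 ∙ y.2) //.
rewrite !(linearED _ _ lD) !(linearEZ _ _ lD) mD.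
rewrite [unitz_inj (D x.2) ∙ y]amulC -!unitz_inj2.
rewrite -(linearED _ _ unitz_inj_linear); congr unitz_inj.
rewrite [y.2 ∙ _]amulC !addrA.
by rewrite [LHS](ACl (3*2*4*1)).
Qed.

Lemma derivation_ideal (D : RU -> RU) (x : RU) :
  derivation D -> (forall y, unit_relator y -> I (D y)) -> I x -> I (D x).
Proof.
move=> [lD mD] DS; elim=> {x}.
- exact: DS.
- by rewrite linearE0 //; exact: Ideal0.
- by move=> x y _ Dx _ Dy; rewrite linearED //; exact: IdealAdd.
- move=> u x Ix Dx; rewrite mD; apply: IdealAdd; last exact: IdealMul.
  exact: IdealMul.
Qed.

Lemma derivation_descends (D : RU -> RU) (D' : RP -> RP) :
  derivation D -> (forall x, D' (rep_proj x) = rep_proj (D x)) -> derivation D'.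
Proof.
move=> [lD mD] DE; split=> [k|]; elim/rep_proj_ind=> x; elim/rep_proj_ind=> y.
  by rewrite -rep_proj_linear !DE lD rep_proj_linear.
by rewrite -rep_projM !DE mD -!rep_projM (linearED _ _ rep_proj_linear).
Qed.

Lemma rep_projP (x y : RU) : rep_proj x = rep_proj y <-> I (x - y).
Proof. exact: qprojP. Qed.

Lemma rep_proj_repr (x : RU) : I (repr (rep_proj x) - x).
Proof. exact: qrepr. Qed.

End PlusTheory.

Section InvariantSubalgebra.
Variables (K : comPzRingType) (A : unitalAlgType K) (M : coalgType K).
Local Notation R := (rep_alg A M).
Local Notation RU := (unitization (rep_alg A M)).
Local Notation RP := (rep_alg_plus A M).
Implicit Type phi : {linear M -> K^o}.

(* delta_phi(alpha) = phi(alpha^2) alpha^1 - phi(alpha^1) alpha^2 *)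
Definition delta_coalg phi (al : M) : M :=
  tlift (fun a1 a2 => (phi a2 : K) *: a1 - (phi a1 : K) *: a2) (comul al).

Definition delta_spec phi (D : RP -> RP) : Prop :=
  [/\ derivation D, D aone = 0 &
      forall a al, D (symb_plus a al) = symb_plus a (delta_coalg phi al)].

Lemma phi_linear phi : linear (phi : M -> K^o).
Proof. by move=> k x y; rewrite linearP. Qed.

Lemma lin_phi phi (U V : lmodType K) (f : U -> M) (y : V) :
  linear f -> linear (fun x : U => (phi (f x) : K) *: y).
Proof.
move=> lf; apply: (lin_scalel (f := fun x => phi (f x))).
exact: lin_comp (phi_linear phi) lf.
Qed.

Lemma delta_bilinear phi :
  bilinear_map (fun a1 a2 : M => (phi a2 : K) *: a1 - (phi a1 : K) *: a2).
Proof.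
split=> x; apply: lin_add; try apply: lin_opp;
  by (apply: lin_scale || apply: lin_phi); lin.
Qed.

Lemma delta_coalg_linear phi : linear (delta_coalg phi).
Proof. by apply: lin_tliftr; [exact: delta_bilinear|lin]. Qed.

Lemma counit_delta phi al : counit (delta_coalg phi al) = 0.
Proof.
have lc : linear (counit : M -> K^o) := counit_linear.
rewrite [LHS](tlift_lin (P := K^o) _ _ lc).
transitivity (phi (tlift (fun y z => counit y *: z) (comul al)) -
              phi (tlift (fun y z => counit z *: y) (comul al)) : K); last first.
  by rewrite counitl counitr subrr.
rewrite !(tlift_lin (P := K^o) _ _ (phi_linear phi)) /tlift -sumrB.
apply: eq_bigr => p _; rewrite (linearED (V := K^o) _ _ lc) -scaleN1r.
rewrite !(linearEZ (V := K^o) _ _ lc) !(linearEZ (V := K^o) _ _ (phi_linear phi)).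
rewrite scaleN1r /GRing.scale /=.
by rewrite mulrC [X in _ - X]mulrC.
Qed.

Lemma delta_exists phi : exists D, delta_spec phi D.
Proof.
have [||D [dD DE]] := @rep_derivation K A M
    (fun a al => symb a (delta_coalg phi al)).
- split=> z; first by lin.
  exact: lin_symbr (delta_coalg_linear phi).
- move=> a b al; rewrite symbM.
  have bs : bilinear_map (fun p q : M => symb a p ∙ symb b q) by bilin.
  have ls := tlift_linear bs.
  pose F1 (x y z : M) : R := (phi z : K) *: (symb a x ∙ symb b y).
  pose F2 (x y z : M) : R := (phi x : K) *: (symb a y ∙ symb b z).
  pose F3 (x y z : M) : R := (phi y : K) *: (symb a x ∙ symb b z).
  pose L (F : M -> M -> M -> R) := tlift (fun y z =>
    tlift (fun y1 y2 => F y1 y2 z) (comul y)) (comul al).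
  pose L' (F : M -> M -> M -> R) := tlift (fun y z =>
    tlift (F y) (comul z)) (comul al).
  have e1 : L F1 = L' F1.
    by apply: coassocE => *; rewrite /F1; [ | |apply: lin_phi]; lin.
  have e2 : L F2 = L' F2.
    by apply: coassocE => *; rewrite /F2; [apply: lin_phi| | ]; lin.
  have e3 : L F3 = L' F3.
    by apply: coassocE => *; rewrite /F3; [ |apply: lin_phi| ]; lin.
  have -> : tlift (fun p q => symb a p ∙ symb b q) (comul (delta_coalg phi al)) =
      L F1 - L' F2.
    rewrite (tlift_lin _ _ comul_linear) (tlift_lin _ _ ls).
    rewrite /L /L' -tliftN -tliftD; apply: eq_tlift => y z.
    rewrite (linearED _ _ comul_linear) -scaleN1r !(linearEZ _ _ comul_linear).
    rewrite (linearED _ _ ls) !(linearEZ _ _ ls) scaleN1r; congr (_ - _).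
      by rewrite (tlift_lin _ _ (lin_scale _ (@lin_id _ R))).
    by rewrite (tlift_lin _ _ (lin_scale _ (@lin_id _ R))).
  transitivity ((L F3 - L F2) + (L' F1 - L' F3)); last first.
    rewrite /L /L' -!tliftN -!tliftD; apply: eq_tlift => y z; congr (_ + _).
      rewrite (tlift_lin _ _ (lin_mull (symb b z) (lin_symbr a (@lin_id _ M)))).
      rewrite -tliftN -tliftD; apply: eq_tlift => u w.
      rewrite (linearED _ _ ((symb_bilinear A M).2 a)).
      rewrite (linearEN _ ((symb_bilinear A M).2 a)).
      rewrite !(linearEZ _ _ ((symb_bilinear A M).2 a)).
      by rewrite amulDl amulNl !amulZl.
    rewrite (tlift_lin _ _ (lin_mulr (symb a y) (lin_symbr b (@lin_id _ M)))).
    rewrite -tliftN -tliftD; apply: eq_tlift => u w.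
    rewrite (linearED _ _ ((symb_bilinear A M).2 b)).
    rewrite (linearEN _ ((symb_bilinear A M).2 b)).
    rewrite !(linearEZ _ _ ((symb_bilinear A M).2 b)).
    by rewrite amulDr amulNr !amulZr.
  by rewrite e1 e2 e3 [RHS]addrC addrA subrK.
have dU := derivation_unitz dD.
have DI := derivation_ideal dU.
have {}DI x : ideal_gen (@unit_relator K A M) x ->
    ideal_gen (@unit_relator K A M) (unitz_inj (D x.2)).
  apply: DI => y [al ->].
  rewrite (_ : _.2 = symb aone al); last by rewrite /= scaler0 subr0.
  rewrite DE; apply: IdealGen; exists (delta_coalg phi al).
  by rewrite counit_delta scale0r subr0.
pose D' (x : RP) := rep_proj (unitz_inj (D (repr x).2)).
have D'E x : D' (rep_proj x) = rep_proj (unitz_inj (D x.2)).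
  apply/rep_projP; have := DI _ (rep_proj_repr x).
  by rewrite (linearED _ _ dU.1) -scaleN1r (linearEZ _ _ dU.1) scaleN1r.
exists D'; split; first exact: derivation_descends D'E.
  rewrite [LHS](D'E aone) /= (linearE0 dD.1).
  by rewrite (linearE0 (@unitz_inj_linear _ _ _)) (linearE0 (@rep_proj_linear _ _ _)).
by move=> a al; rewrite D'E /= DE.
Qed.

(* A_M^+ is generated as an algebra by e and the classes of the symbols. *)
Lemma rep_plus_ind (P : RP -> Prop) :
  (forall a al, P (symb_plus a al)) -> P aone ->
  (forall k x y, P x -> P y -> P (k *: x + y)) ->
  (forall x y, P x -> P y -> P (x ∙ y)) -> forall x, P x.
Proof.
move=> Ps P1 PD PM; elim/rep_proj_ind=> -[k x].
have P0 : P 0 by have := PD (-1) _ _ P1 P1; rewrite scaleN1r addNr.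
have -> : rep_proj (k, x) = (k : K) *: (aone : RP) + rep_proj (unitz_inj x).
  rewrite -[aone in _ *: aone]/(rep_proj aone) -rep_proj_linear; congr rep_proj.
  by congr (_, _); rewrite /= ?scaler0 ?add0r // /GRing.scale /= mulr1 addr0.
apply: (PD) => //; elim/rep_alg_ind: x.
- exact: Ps.
- by rewrite (linearE0 (@unitz_inj_linear _ _ _)) (linearE0 (@rep_proj_linear _ _ _)).
- move=> l x y Px Py; rewrite unitz_inj_linear rep_proj_linear; exact: PD.
- move=> x y Px Py; rewrite (_ : unitz_inj _ = unitz_inj x ∙ unitz_inj y).
    by rewrite rep_projM; exact: PM.
  by rewrite -unitz_inj2 /= scale0r addr0.
Qed.

Lemma delta_unique phi D D' :
  delta_spec phi D -> delta_spec phi D' -> forall x, D x = D' x.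
Proof.
move=> [[l m] D1 DE] [[l' m'] D1' DE']; elim/rep_plus_ind.
- by move=> a al; rewrite DE DE'.
- by rewrite D1 D1'.
- by move=> k x y Hx Hy; rewrite l l' Hx Hy.
- by move=> x y Hx Hy; rewrite m m' Hx Hy.
Qed.

Definition delta phi : RP -> RP := sval (cid (delta_exists phi)).

Lemma deltaP phi : delta_spec phi (delta phi).
Proof. exact: svalP. Qed.

(* The subalgebra E of A_M^+, as a subtype *)
Definition in_invariants : pred RP := fun x => `[< forall phi, delta phi x = 0 >].

Definition invariants := {x : RP | in_invariants x}.
Definition invariants_val (x : invariants) : RP := \val x.

HB.instance Definition _ := [isSub for invariants_val].
HB.instance Definition _ := [Choice of invariants by <:].

Fact invariants_submod : submod_closed in_invariants.
Proof.
split; first by apply/asboolP => phi; case: (deltaP phi) => -[l _] _ _; exact: linearE0.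
move=> k x y /asboolP Ex /asboolP Ey; apply/asboolP => phi.
by case: (deltaP phi) => -[l _] _ _; rewrite l Ex Ey scaler0 addr0.
Qed.

HB.instance Definition _ := GRing.SubChoice_isSubLmodule.Build K RP
  in_invariants invariants invariants_submod.

Fact invariantsM (x y : invariants) : in_invariants (\val x ∙ \val y).
Proof.
have /asboolP Ex := valP x; have /asboolP Ey := valP y.
apply/asboolP => phi; case: (deltaP phi) => -[_ m] _ _.
by rewrite m Ex Ey amul0l amul0r addr0.
Qed.

Fact invariants1 : in_invariants aone.
Proof. by apply/asboolP => phi; case: (deltaP phi). Qed.

Definition invariants_mul (x y : invariants) : invariants := Sub _ (invariantsM x y).
Definition invariants_one : invariants := Sub _ invariants1.

Fact invariants_mulA : associative invariants_mul.
Proof. by move=> x y z; apply: val_inj; rewrite !SubK amulA. Qed.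

Fact invariants_mulC : commutative invariants_mul.
Proof. by move=> x y; apply: val_inj; rewrite !SubK amulC. Qed.

Fact invariants_mul_bilinear : bilinear_map invariants_mul.
Proof.
have H y : linear (invariants_mul^~ y).
  by move=> k x z; apply: val_inj; rewrite !(SubK, linearP) amul_linearl.
by split=> // x k y z; rewrite !(invariants_mulC x); exact: H.
Qed.

Fact invariants_mul1 : left_id invariants_one invariants_mul.
Proof. by move=> x; apply: val_inj; rewrite !SubK amul1. Qed.

Fact invariants_mul1r : right_id invariants_one invariants_mul.
Proof. by move=> x; apply: val_inj; rewrite !SubK amul1r. Qed.

HB.instance Definition _ :=
  isAssocAlgebra.Build K invariants invariants_mulA invariants_mul_bilinear.
HB.instance Definition _ :=
  hasAlgUnit.Build K invariants invariants_mul1 invariants_mul1r.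
HB.instance Definition _ := isCommAlgebra.Build K invariants invariants_mulC.

End InvariantSubalgebra.

Section PlusBracket.
Variables (K : comPzRingType) (A : unitalAlgType K) (M : coalgType K).
Variables (d : double_bracket A) (v : cyclic_form M).
Local Notation R := (rep_alg A M).
Local Notation RU := (unitization (rep_alg A M)).
Local Notation RP := (rep_alg_plus A M).
Local Notation I := (ideal_gen (@unit_relator K A M)).

(* {-,-}_v extended to K e (+) A_M by {e, -} = {-, e} = 0 *)
Definition unitz_bracket (x y : RU) : RU := unitz_inj (rep_bracket d v x.2 y.2).

(* {-,-}_v^+, computed on representatives *)
Definition rep_bracket_plus (x y : RP) : RP :=
  rep_proj (unitz_bracket (repr x) (repr y)).

Lemma dbr1 a : d (aone ⊗ a) = 0.
Proof.
have := dbr_leibl d aone aone a; rewrite amul1.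
set t := d _; have il (c : A) : linear (innerl c) by apply: tlift_linear; bilin.
have ir (c : A) : linear (@innerr _ A ^~ c) by apply: tlift_linear; bilin.
have -> : innerl aone t = t.
  move: t; apply: eq_tens_linear; [exact: il|exact: lin_id|move=> x y].
  by rewrite /innerl tlift_pure ?amul1 //; bilin.
have -> : innerr t aone = t.
  move: t; apply: eq_tens_linear; [exact: ir|exact: lin_id|move=> x y].
  by rewrite /innerr tlift_pure ?amul1r //; bilin.
by move/eqP; rewrite -subr_eq subrr => /eqP.
Qed.

Lemma unitz_bracketl (x y : RU) : I x -> I (unitz_bracket x y).
Proof.
have [[_ dl] _ brE] := rep_bracketP d v.
have dr z : derivation (rep_bracket d v z) by case: (rep_bracketP d v) => -[].
move=> Ix; have dU := derivation_unitz (dl y.2).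
apply: (derivation_ideal dU) Ix => _ [al ->].
rewrite (_ : _.2 = symb aone al); last by rewrite /= scaler0 subr0.
rewrite (derivation_eq0 (dr _)) ?(linearE0 (@unitz_inj_linear _ _ _)).
  exact: Ideal0.
move=> b be; rewrite brE dbr1; exact: linearE0 (symb_form_linear _ _ _).
Qed.

Lemma unitz_bracketC (x y : RU) : unitz_bracket y x = - unitz_bracket x y.
Proof.
have [_ brC _] := rep_bracketP d v.
rewrite /unitz_bracket brC -scaleN1r (linearEZ _ _ (@unitz_inj_linear _ _ _)).
by rewrite scaleN1r.
Qed.

Lemma rep_bracket_plusE (x y : RU) :
  rep_bracket_plus (rep_proj x) (rep_proj y) = rep_proj (unitz_bracket x y).
Proof.
have H (z z' w : RU) : I (z' - z) ->
    rep_proj (unitz_bracket z' w) = rep_proj (unitz_bracket z w).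
  move=> Iz; apply/rep_projP; have := unitz_bracketl w Iz.
  have [[_ dl] _ _] := rep_bracketP d v; have [l _] := derivation_unitz (dl w.2).
  by rewrite /unitz_bracket (linearED _ _ l) -scaleN1r (linearEZ _ _ l) scaleN1r.
rewrite /rep_bracket_plus (H _ _ _ (rep_proj_repr x)) unitz_bracketC.
rewrite -scaleN1r (linearEZ _ _ (@rep_proj_linear _ _ _)) (H _ _ _ (rep_proj_repr y)).
rewrite unitz_bracketC -scaleN1r (linearEZ _ _ (@rep_proj_linear _ _ _)).
by rewrite !scaleN1r opprK.
Qed.

Lemma rep_bracket_plus_antisymmetric : antisymmetric_bracket rep_bracket_plus.
Proof.
elim/rep_proj_ind=> x; elim/rep_proj_ind=> y; rewrite !rep_bracket_plusE.
rewrite unitz_bracketC -scaleN1r (linearEZ _ _ (@rep_proj_linear _ _ _)).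
by rewrite scaleN1r.
Qed.

Lemma rep_bracket_plus_biderivation : biderivation rep_bracket_plus.
Proof.
have [[dr dl] _ _] := rep_bracketP d v; split; elim/rep_proj_ind=> x.
  apply: derivation_descends (derivation_unitz (dr x.2)) _ => y.
  exact: rep_bracket_plusE.
apply: derivation_descends (derivation_unitz (dl x.2)) _ => y.
exact: rep_bracket_plusE.
Qed.

End PlusBracket.

(* Main.v *)
Require Import Defs.
From HB Require Import structures.
From mathcomp Require Import all_boot all_order all_algebra.
From mathcomp Require Import boolp functions.

Set Implicit Arguments.
Unset Strict Implicit.
Unset Printing Implicit Defensive.

Import GRing.Theory.
Local Open Scope ring_scope.

(** Write [B] for [A_M^+].  All the index bookkeeping takes place in the
    convolution algebra [H = Hom(M, B)], a unital, usually non-commutative,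
    associative algebra.  An element [a] of [A] gives [sym a : al |-> a_al] in
    [H], and the relations of [A_M^+] say exactly that [sym] is a morphism of
    unital algebras.  A functional [phi] on [M] gives [phi * e] in [H]; in
    particular each [al] gives [v_al = v(al, -) e].  In these terms the bracket
    is [{a_al, b_be} = (sym d' * v_al * sym d'')(be)] with [d = {{a, b}}], and the
    cyclicity of [v], together with the commutativity of [B], reads
    [(f * v_al * g)(be) = (g * v_be * f)(al)] for all [f], [g] in [H]
    ([conv_form_cyclic]).  Everything about [v] follows from this identity.

    Jacobi identity.  A derivation of [B] acts on [H] by composition, and this
    is a derivation of [H] that kills the functionals.  Hence an iterated bracket
    [{a_al, {b_be, c_ga}}] is a sum of two words
    [sym x * v * sym y * v * sym z] taken at [ga], and rotating these words by
    cyclicity collects the six terms of the Jacobiator of [a_al], [b_be], [c_ga]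
    into two, made from the tribrackets of [a, b, c] and of [a, c, b]
    ([jacobiator_symb]).  Substituting the quasi-Poisson formula, the eight
    terms of each tribracket pair off so that [a] and [al] occur only through
    the commutator [X = v_al * sym a - sym a * v_al] ([quasi_Poisson_triple]).
    By cyclicity again, [X(ga) = delta_phi(a_al)] with [phi = v(ga, -)].
    So the Jacobiator, as a function of its first argument, agrees on the
    generators of [B] with a [B]-linear combination of the derivations
    [delta_phi].  Both are derivations, so they agree on [B]
    ([jacobiator_delta]), and the Jacobiator vanishes as soon as its first
    argument lies in [E], the others being arbitrary.

    Closure of [E].  Each [delta_phi] is a derivation of the bracket
    ([delta_bracket]): on [H] it sends [sym a] to the commutator
    [sym a * phi - phi * sym a], and [v] is invariant in the sense that
    [v_(delta_phi al)] is the commutator of [phi] and [v_al]. *)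

(** * Multilinear maps on tensor products *)

Section TensorLemmas.
Variable K : comPzRingType.

Lemma tflip_bilinear (U V : lmodType K) :
  bilinear_map (fun (x : U) (y : V) => y ⊗ x).
Proof. by bilin. Qed.

Lemma tflip_linear (U V : lmodType K) : linear (@tflip K U V).
Proof. exact: tlift_linear (tflip_bilinear _ _). Qed.

Lemma tflip_pure (U V : lmodType K) (x : U) (y : V) : tflip (x ⊗ y) = y ⊗ x.
Proof. exact: tlift_pure (tflip_bilinear _ _) _ _. Qed.

Lemma tflipK (U V : lmodType K) (t : (U ⊗ V)%type) : tflip (tflip t) = t.
Proof.
move: t; apply: eq_tens_linear; [|exact: lin_id|by move=> x y; rewrite !tflip_pure].
exact: lin_comp (@tflip_linear _ _) (@tflip_linear _ _).
Qed.

Lemma tmap_bilinear (M1 N1 M2 N2 : lmodType K) (f : M1 -> M2) (g : N1 -> N2) :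
  linear f -> linear g -> bilinear_map (fun x y => f x ⊗ g y).
Proof. by move=> lf lg; split=> ? /=; [exact: lin_purel|exact: lin_purer]. Qed.

Lemma tunassoc_bilinear (M1 M2 M3 : lmodType K) :
  bilinear_map (fun (x : M1) => tlift (fun (y : M2) (z : M3) => x ⊗ y ⊗ z)).
Proof.
split=> w; first by apply: lin_tlift => ? ?; lin.
by apply: tlift_linear; bilin.
Qed.

Lemma tlift3_bilinear (M1 M2 M3 P : lmodType K) (f : M1 -> M2 -> M3 -> P) :
  (forall y z, linear (fun x => f x y z)) ->
  (forall x z, linear (fun y => f x y z)) ->
  (forall x y, linear (f x y)) ->
  bilinear_map (fun u z => tlift (fun x y => f x y z) u).
Proof.
move=> f1 f2 f3; split=> w; last by apply: lin_tlift => ? ?.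
by apply: tlift_linear; split=> ?.
Qed.

Lemma tlift3_linear (M1 M2 M3 P : lmodType K) (f : M1 -> M2 -> M3 -> P) :
  (forall y z, linear (fun x => f x y z)) ->
  (forall x z, linear (fun y => f x y z)) ->
  (forall x y, linear (f x y)) -> linear (tlift3 f).
Proof. by move=> f1 f2 f3; exact: tlift_linear (tlift3_bilinear f1 f2 f3). Qed.

Lemma tlift3_pure (M1 M2 M3 P : lmodType K) (f : M1 -> M2 -> M3 -> P) x y z :
  (forall y z, linear (fun x => f x y z)) ->
  (forall x z, linear (fun y => f x y z)) ->
  (forall x y, linear (f x y)) -> tlift3 f (x ⊗ y ⊗ z) = f x y z.
Proof.
move=> f1 f2 f3; rewrite /tlift3 (tlift_pure (tlift3_bilinear f1 f2 f3)).
by rewrite tlift_pure //; split=> ?.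
Qed.

Lemma P312_linear (N : lmodType K) : linear (@P312 K N).
Proof. by apply: tlift3_linear => *; lin. Qed.

Lemma P312_pure (N : lmodType K) (x y z : N) : P312 (x ⊗ y ⊗ z) = z ⊗ x ⊗ y.
Proof. by apply: tlift3_pure => *; lin. Qed.

Lemma P231_pure (N : lmodType K) (x y z : N) : P231 (x ⊗ y ⊗ z) = y ⊗ z ⊗ x.
Proof. by apply: tlift3_pure => *; lin. Qed.

End TensorLemmas.

(** * The convolution algebra *)

Section ConvolutionAlgebra.
Variables (K : comPzRingType) (M : coalgType K) (B : comUnitalAlgType K).

(** Being linear is a property of plain functions here, so that the module
    structure can be inherited from that of all functions [M -> B]. *)
Definition linear_pred : pred (M -> B) := fun f => `[< linear f >].

Definition convolution := {f : M -> B | linear_pred f}.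
Definition conv_fun (f : convolution) : M -> B := \val f.
Coercion conv_fun : convolution >-> Funclass.

HB.instance Definition _ := [isSub for conv_fun].
HB.instance Definition _ := [Choice of convolution by <:].

Fact linear_pred_submod : submod_closed linear_pred.
Proof.
split; first by apply/asboolP => k x y; rewrite /= /GRing.zero /= scaler0 addr0.
move=> k f g /asboolP lf /asboolP lg; apply/asboolP.
exact: lin_add (lin_scale k lf) lg.
Qed.

HB.instance Definition _ := GRing.SubChoice_isSubLmodule.Build K (M -> B)
  linear_pred convolution linear_pred_submod.

Lemma conv_linear (f : convolution) : linear f.
Proof. exact/asboolP/(valP f). Qed.

Lemma convP (f g : convolution) : f =1 g -> f = g.
Proof. by move=> fg; apply: val_inj; apply/funext. Qed.

Definition mk_conv (f : M -> B) (lf : linear f) : convolution :=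
  Sub f (introT (asboolP _) lf).

Lemma convD (f g : convolution) x : (f + g : convolution) x = f x + g x. Proof. by []. Qed.
Lemma convN (f : convolution) x : (- f : convolution) x = - f x. Proof. by []. Qed.
Lemma convZ k (f : convolution) x : (k *: f : convolution) x = k *: f x. Proof. by []. Qed.

Lemma eval_linear x : linear (fun f : convolution => f x).
Proof. by []. Qed.

Lemma lin_conv (U : lmodType K) (g : U -> M) (f : convolution) :
  linear g -> linear (fun x => f (g x)).
Proof. exact: lin_comp (conv_linear f). Qed.


Ltac clin := repeat first [ progress lin | apply: lin_conv ].

Fact conv_mul_linear (f g : convolution) :
  linear (fun x => tlift (fun y z => f y ∙ g z) (comul x)).
Proof.
apply: lin_tliftr; last by lin.
by split=> ? /=; clin.
Qed.

Definition conv_mul (f g : convolution) : convolution := mk_conv (conv_mul_linear f g).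

Fact conv_unit_linear : linear (fun x : M => counit x *: (aone : B)).
Proof. by apply: lin_scalel; exact: counit_linear. Qed.

Definition conv_unit : convolution := mk_conv conv_unit_linear.

Fact conv_mulA : associative conv_mul.
Proof.
move=> f g h; apply: convP => x.
transitivity (tlift (fun y z => tlift (fun z1 z2 => f y ∙ g z1 ∙ h z2) (comul z))
  (comul x)).
  apply: eq_tlift => y z; rewrite (tlift_lin _ _ (amul_linearr _)).
  by apply: eq_tlift => z1 z2; rewrite amulA.
rewrite -(@coassocE _ _ _ (fun y z1 z2 => f y ∙ g z1 ∙ h z2)); first last.
- by move=> *; clin.
- by move=> *; clin.
- by move=> *; clin.
by apply: eq_tlift => y z; rewrite (tlift_lin _ _ (amul_linearl _)).
Qed.

Fact conv_mul_bilinear : bilinear_map conv_mul.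
Proof.
by split=> ? k f g; apply: convP => x; rewrite convD convZ; move: k f g;
   apply: lin_tlift => ? ?; [apply: lin_mull|apply: lin_mulr].
Qed.

Fact conv_mul1 : left_id conv_unit conv_mul.
Proof.
move=> f; apply: convP => x; rewrite -[in RHS](counitl x).
rewrite (tlift_lin _ _ (conv_linear f)); apply: eq_tlift => y z /=.
by rewrite amulZl amul1 (linearEZ _ _ (conv_linear f)).
Qed.

Fact conv_mul1r : right_id conv_unit conv_mul.
Proof.
move=> f; apply: convP => x; rewrite -[in RHS](counitr x).
rewrite (tlift_lin _ _ (conv_linear f)); apply: eq_tlift => y z /=.
by rewrite amulZr amul1r (linearEZ _ _ (conv_linear f)).
Qed.

HB.instance Definition _ :=
  isAssocAlgebra.Build K convolution conv_mulA conv_mul_bilinear.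
HB.instance Definition _ := hasAlgUnit.Build K convolution conv_mul1 conv_mul1r.

Lemma convM (f g : convolution) x :
  (f ∙ g : convolution) x = tlift (fun y z => f y ∙ g z) (comul x).
Proof. by []. Qed.

Lemma conv1 x : (aone : convolution) x = counit x *: aone.
Proof. by []. Qed.

(** The three-factor product in terms of [comul3], the form in which both the
    bracket and the cyclicity of the form are given. *)
Lemma conv_sandwich (f X g : convolution) x :
  (f ∙ X ∙ g : convolution) x =
  tlift3 (fun x1 x2 x3 => f x1 ∙ X x2 ∙ g x3) (comul3 x).
Proof.
rewrite comul3l; try by move=> *; clin.
by apply: eq_tlift => y z; rewrite (tlift_lin _ _ (amul_linearl _)).
Qed.

(** Functionals become elements of the algebra through the unit of [B]. *)
Fact conv_scalar_linear (phi : {linear M -> K^o}) :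
  linear (fun x : M => (phi x : K) *: (aone : B)).
Proof. by apply: lin_scalel; exact: phi_linear. Qed.

Definition conv_scalar phi : convolution := mk_conv (conv_scalar_linear phi).

Fact comp_linear (D : B -> B) (lD : linear D) (f : convolution) :
  linear (fun x => D (f x)).
Proof. exact: lin_comp lD (conv_linear f). Qed.

Definition conv_comp D (lD : linear D) f : convolution := mk_conv (comp_linear lD f).

End ConvolutionAlgebra.

(** * Derivations *)

Section Derivations.
Variables (K : comPzRingType).

Lemma derivation1 (B : unitalAlgType K) (D : B -> B) : derivation D -> D aone = 0.
Proof.
move=> [_ mD]; have := mD aone aone; rewrite amul1 amul1 amul1r.
by move/eqP; rewrite -subr_eq subrr => /eqP.
Qed.

Lemma conv_comp_derivation (M : coalgType K) (B : comUnitalAlgType K)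
    (D : B -> B) (dD : derivation D) :
  derivation (@conv_comp K M B D dD.1).
Proof.
case: dD => lD mD; split=> [k f g|f g]; apply: convP => x.
  exact: lD.
rewrite convD !convM -tliftD [LHS](tlift_lin _ _ lD).
by apply: eq_tlift => y z; rewrite mD.
Qed.

Lemma conv_comp_scalar (M : coalgType K) (B : comUnitalAlgType K)
    (D : B -> B) (dD : derivation D) (phi : {linear M -> K^o}) :
  conv_comp dD.1 (conv_scalar B phi) = 0.
Proof.
apply: convP => x; transitivity (D ((phi x : K) *: aone)) => //.
by rewrite (linearEZ _ _ dD.1) derivation1 // scaler0.
Qed.

Lemma derivation_commutator (B : assocAlgType K) (D D' : B -> B) :
  derivation D -> derivation D' -> derivation (fun x => D (D' x) - D' (D x)).
Proof.
move=> [lD mD] [lD' mD']; split=> [|x y].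
  by apply: lin_add; [|apply: lin_opp]; apply: lin_comp.
rewrite mD' mD (linearED _ _ lD) (linearED _ _ lD') !mD !mD' amulDl amulDr.
rewrite amulNl amulNr !opprD !addrA.
rewrite [LHS](ACl (1*5*4*8*2*7*3*6)) /=.
by rewrite !addrK.
Qed.

Lemma derivationD (B : assocAlgType K) (D D' : B -> B) :
  derivation D -> derivation D' -> derivation (fun x => D x + D' x).
Proof.
move=> [lD mD] [lD' mD']; split=> [|x y]; first exact: lin_add.
by rewrite mD mD' amulDl amulDr addrACA.
Qed.

End Derivations.

(** * Cyclic forms *)

Section CyclicConvolution.
Variables (K : comPzRingType) (M : coalgType K) (v : cyclic_form M).
Variable (B : comUnitalAlgType K).
Local Notation H := (convolution M B).

Definition form_at (al : M) (x : M) : K^o := v (al ⊗ x).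

Fact form_at_linear al : linear (form_at al).
Proof. by apply: lin_comp (@cform_linear _ _ v) _; lin. Qed.

HB.instance Definition _ al :=
  GRing.isLinear.Build K M K^o _ (form_at al) (form_at_linear al).

Definition conv_form al : H := conv_scalar B (form_at al).

Lemma sandwich_formE (f g : H) al be :
  (f ∙ conv_form al ∙ g : H) be =
  tlift3 (fun b1 b2 b3 => v (al ⊗ b2) *: (f b1 ∙ g b3)) (comul3 be).
Proof.
rewrite conv_sandwich; apply: eq_tlift => u z; apply: eq_tlift => x y.
by rewrite amulZr amul1r amulZl.
Qed.

(** Both sides are values of the bilinear map [f(x) g(y)] at [form_hat v], once
    at [al ⊗ be] and once, after commuting the factors in [B], at the flipped
    tensor: this is where cyclicity says that the two agree. *)
Lemma conv_form_cyclic (f g : H) al be :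
  (f ∙ conv_form al ∙ g : H) be = (g ∙ conv_form be ∙ f : H) al.
Proof.
have bfg (f1 g1 : H) : bilinear_map (fun p q : M => f1 p ∙ g1 q).
  by split=> ? /=; [apply: lin_mull|apply: lin_mulr]; exact: conv_linear.
have hatE (f1 g1 : H) p q : (f1 ∙ conv_form p ∙ g1 : H) q =
    tlift (fun x y : M => f1 x ∙ g1 y) (form_hat v (p ⊗ q)).
  have L := tlift_linear (bfg f1 g1).
  rewrite sandwich_formE /form_hat tlift_pure; last first.
    split=> w.
      apply: lin_tlift => u z; apply: lin_tlift => p1 p2; apply: lin_scalel.
      by apply: lin_comp (@cform_linear _ _ v) _; lin.
    apply: lin_tliftr.
      split=> z; last by lin.
      apply: tlift_linear; split=> u; [by lin|apply: lin_scalel].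
      by apply: lin_comp (@cform_linear _ _ v) _; lin.
    apply: lin_tliftr; last by lin.
    by split=> ?; lin.
  rewrite (tlift_lin _ _ L); apply: eq_tlift => u z.
  rewrite (tlift_lin _ _ L); apply: eq_tlift => p1 p2.
  by rewrite (linearEZ _ _ L) (tlift_pure (bfg f1 g1)).
rewrite !hatE.
have -> : be ⊗ al = tflip (al ⊗ be) by rewrite tflip_pure.
rewrite cform_cyclic; set t := form_hat v _; move: t; apply: eq_tens_linear.
- exact: tlift_linear (bfg _ _).
- by apply: lin_tliftr; [exact: bfg|exact: tflip_linear].
by move=> p q; rewrite tflip_pure !(tlift_pure (bfg _ _)) amulC.
Qed.

(** With the counit as one of the two factors, cyclicity moves a coproduct from
    one argument of the form to the other. *)
Lemma conv_form_right (f : H) al be :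
  (f ∙ conv_form al : H) be = (conv_form be ∙ f : H) al.
Proof.
have := conv_form_cyclic f aone al be.
by rewrite (@amul1r K H) (@amul1 K H).
Qed.

Lemma conv_form_left (f : H) al be :
  (conv_form al ∙ f : H) be = (f ∙ conv_form be : H) al.
Proof. by rewrite -conv_form_right. Qed.

End CyclicConvolution.

(** * Symbols as convolution elements *)

Section UniversalSymbols.
Variables (K : comPzRingType) (A : unitalAlgType K) (M : coalgType K).
Local Notation B := (rep_alg_plus A M).
Local Notation H := (convolution M B).

Fact symb_plus_linearl al : linear (fun a : A => symb_plus a al : B).
Proof.
apply: lin_comp (@rep_proj_linear _ _ _) _.
by apply: lin_comp (@unitz_inj_linear _ _ _) _; lin.
Qed.

Fact symb_plus_linearr a : linear (symb_plus a : M -> B).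
Proof.
apply: lin_comp (@rep_proj_linear _ _ _) _.
by apply: lin_comp (@unitz_inj_linear _ _ _) _; lin.
Qed.

Definition conv_symb a : H := mk_conv (symb_plus_linearr a).

Lemma conv_symb_linear : linear conv_symb.
Proof. by move=> k a b; apply: convP => al; exact: symb_plus_linearl. Qed.

Lemma rep_proj_inj_linear : linear (fun x : rep_alg A M => rep_proj (unitz_inj x)).
Proof. exact: lin_comp (@rep_proj_linear _ _ _) (@unitz_inj_linear _ _ _). Qed.

Lemma rep_proj_injM (x y : rep_alg A M) :
  rep_proj (unitz_inj (x ∙ y)) = rep_proj (unitz_inj x) ∙ rep_proj (unitz_inj y).
Proof. by rewrite -rep_projM -unitz_inj2 /= scale0r addr0. Qed.

Lemma conv_symbM a b : conv_symb (a ∙ b) = conv_symb a ∙ conv_symb b.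
Proof.
apply: convP => al; rewrite convM.
transitivity (rep_proj (unitz_inj (symb (a ∙ b) al))) => //.
rewrite symbM (tlift_lin _ _ rep_proj_inj_linear).
by apply: eq_tlift => x y; rewrite rep_proj_injM.
Qed.

Lemma conv_symb1 : conv_symb aone = aone.
Proof.
apply: convP => al; rewrite conv1; transitivity (rep_proj
  (counit al *: (aone : unitization (rep_alg A M)))).
  by apply/rep_projP; apply: IdealGen; exists al.
by rewrite (linearEZ _ _ (@rep_proj_linear _ _ _)).
Qed.

Lemma derivation_ext (D D' : B -> B) : derivation D -> derivation D' ->
  (forall a al, D (conv_symb a al) = D' (conv_symb a al)) -> D =1 D'.
Proof.
move=> dD dD' DD'; elim/rep_plus_ind.
- exact: DD'.
- by rewrite !derivation1.
- by move=> k x y Hx Hy; rewrite dD.1 dD'.1 Hx Hy.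
- by move=> x y Hx Hy; rewrite dD.2 dD'.2 Hx Hy.
Qed.

(** With [phi = v_al] and [t = {{a, b}}] this is [be |-> {a_al, b_be}]. *)
Definition pair_conv (phi : H) : (A ⊗ A)%type -> H :=
  tlift (fun x y => conv_symb x ∙ phi ∙ conv_symb y).

Lemma pair_conv_bilinear (phi : H) :
  bilinear_map (fun x y : A => conv_symb x ∙ phi ∙ conv_symb y).
Proof. by split=> ? /=; lin; exact: conv_symb_linear. Qed.

Lemma pair_conv_linear phi : linear (pair_conv phi).
Proof. exact: tlift_linear (pair_conv_bilinear phi). Qed.

Lemma pair_conv_pure phi x y :
  pair_conv phi (x ⊗ y) = conv_symb x ∙ phi ∙ conv_symb y.
Proof. exact: tlift_pure (pair_conv_bilinear phi) _ _. Qed.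

Definition triple_conv (phi psi : H) : (A ⊗ A ⊗ A)%type -> H :=
  tlift3 (fun x y z => conv_symb x ∙ phi ∙ conv_symb y ∙ psi ∙ conv_symb z).

Lemma triple_conv_bilinear (phi psi : H) :
  bilinear_map (fun (u : (A ⊗ A)%type) z =>
    tlift (fun x y => conv_symb x ∙ phi ∙ conv_symb y ∙ psi ∙ conv_symb z) u).
Proof.
split=> w; last by lin; exact: conv_symb_linear.
by apply: tlift_linear; split=> ? /=; lin; exact: conv_symb_linear.
Qed.

Lemma triple_conv_linear phi psi : linear (triple_conv phi psi).
Proof. exact: tlift_linear (triple_conv_bilinear phi psi). Qed.

Lemma triple_conv_pure phi psi x y z : triple_conv phi psi (x ⊗ y ⊗ z) =
  conv_symb x ∙ phi ∙ conv_symb y ∙ psi ∙ conv_symb z.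
Proof.
rewrite /triple_conv /tlift3 (tlift_pure (triple_conv_bilinear phi psi)).
by rewrite tlift_pure //; split=> ? /=; lin; exact: conv_symb_linear.
Qed.

End UniversalSymbols.

(** * The tribracket *)

Section Tribracket.
Variables (K : comPzRingType) (A : unitalAlgType K) (M : coalgType K).
Variables (d : double_bracket A).
Local Notation B := (rep_alg_plus A M).
Local Notation H := (convolution M B).

Definition dbr_left (a : A) (t : (A ⊗ A)%type) : (A ⊗ A ⊗ A)%type :=
  tmap d idfun (tunassoc (a ⊗ t)).

Definition dbr_twice (a b c : A) : (A ⊗ A ⊗ A)%type := dbr_left a (d (b ⊗ c)).

Lemma dbr_left_linear a : linear (dbr_left a).
Proof.
apply: lin_comp (tlift_linear (tmap_bilinear (dbr_linear d) (@lin_id _ A))) _.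
by apply: lin_comp (tlift_linear (@tunassoc_bilinear _ _ _ _)) _; lin.
Qed.

Lemma dbr_left_pure a x y : dbr_left a (x ⊗ y) = d (a ⊗ x) ⊗ y.
Proof.
rewrite /dbr_left /tunassoc (tlift_pure (@tunassoc_bilinear _ _ _ _)).
rewrite tlift_pure; last by bilin.
by rewrite /tmap tlift_pure //; exact: tmap_bilinear (dbr_linear d) (@lin_id _ A).
Qed.

Lemma dbr_twiceE a b c :
  tmap d idfun (tunassoc (tmap idfun d (tassoc (a ⊗ b ⊗ c)))) = dbr_twice a b c.
Proof.
rewrite /tassoc tlift3_pure; try by move=> *; lin.
rewrite {2}/tmap tlift_pure //; exact: tmap_bilinear (@lin_id _ A) (dbr_linear d).
Qed.

Lemma tribracket_pure a b c : tribracket d (a ⊗ b ⊗ c) =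
  dbr_twice a b c + P312 (dbr_twice b c a) + P312 (P312 (dbr_twice c a b)).
Proof.
rewrite /tribracket !big_ord_recr /= big_ord0 add0r.
by rewrite !P231_pure !dbr_twiceE.
Qed.

Lemma triple_conv_purer (phi psi : H) (t : (A ⊗ A)%type) (z : A) :
  triple_conv phi psi (t ⊗ z) = pair_conv phi t ∙ psi ∙ conv_symb M z.
Proof.
rewrite /triple_conv /tlift3 (tlift_pure (triple_conv_bilinear phi psi)).
rewrite -(@tlift_lin _ _ _ _ _ _ (fun u : H => u ∙ psi ∙ conv_symb M z)) //.
by lin.
Qed.

Lemma triple_conv_P312 (phi psi : H) (t : (A ⊗ A)%type) (z : A) :
  triple_conv phi psi (P312 (t ⊗ z)) = conv_symb M z ∙ phi ∙ pair_conv psi t.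
Proof.
move: t; apply: eq_tens_linear.
- apply: lin_comp (triple_conv_linear _ _) _.
  by apply: lin_comp (@P312_linear _ A) _; lin.
- by apply: lin_mulr; exact: pair_conv_linear.
by move=> x y; rewrite P312_pure triple_conv_pure pair_conv_pure !amulA.
Qed.

End Tribracket.

(** * The bracket on symbols and its Jacobiator *)

Section SymbolBracket.
Variables (K : comPzRingType) (A : unitalAlgType K) (M : coalgType K).
Variables (d : double_bracket A) (v : cyclic_form M).
Local Notation B := (rep_alg_plus A M).
Local Notation H := (convolution M B).
Local Notation br := (rep_bracket_plus d v).
Local Notation vform := (conv_form v B).
Local Notation sym := (@conv_symb K A M).

Lemma bracket_antisym (x y : B) : br y x = - br x y.
Proof. exact: rep_bracket_plus_antisymmetric. Qed.

Lemma derivation_bracketr (x : B) : derivation (br x).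
Proof. exact: (rep_bracket_plus_biderivation d v).1. Qed.

Lemma derivation_bracketl (y : B) : derivation (br^~ y).
Proof. exact: (rep_bracket_plus_biderivation d v).2. Qed.

Lemma bracket_symb a b al be :
  br (sym a al) (sym b be) = pair_conv (vform al) (d (a ⊗ b)) be.
Proof.
have -> : br (sym a al) (sym b be) =
    rep_proj (unitz_inj (symb_form v al be (d (a ⊗ b)))).
  rewrite -(let: And3 _ _ brE := rep_bracketP d v in brE a b al be).
  exact: rep_bracket_plusE.
move: (d _); apply: eq_tens_linear.
- exact: lin_comp (@rep_proj_inj_linear _ _ _) (symb_form_linear _ _ _).
- exact: lin_comp (eval_linear _) (pair_conv_linear _).
move=> x y; rewrite pair_conv_pure sandwich_formE symb_form_pure.
rewrite (tlift_lin _ _ (@rep_proj_inj_linear _ _ _)); apply: eq_tlift => u z.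
rewrite (tlift_lin _ _ (@rep_proj_inj_linear _ _ _)); apply: eq_tlift => p q.
by rewrite (linearEZ _ _ (@rep_proj_inj_linear _ _ _)) rep_proj_injM.
Qed.

Local Notation ad a al := (conv_comp (derivation_bracketr (sym a al)).1).

Lemma ad_symb a al b : ad a al (sym b) = pair_conv (vform al) (d (a ⊗ b)).
Proof. by apply: convP => be; exact: bracket_symb. Qed.

(** Leibniz rule for [sym x * v_be * sym y]: bracketing the left factor gives
    [{{a, x}} ⊗ y], and bracketing the right factor puts [x] in front of
    [{{a, y}}], which is the rotation of [{{a, y}} ⊗ x]. *)
Lemma ad_pair_conv a al be t : ad a al (pair_conv (vform be) t) =
  triple_conv (vform al) (vform be) (dbr_left d a t) +
  triple_conv (vform be) (vform al) (P312 (dbr_left d a (tflip t))).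
Proof.
have [lD mD] := conv_comp_derivation M (derivation_bracketr (sym a al)).
move: t; apply: eq_tens_linear.
- exact: lin_comp lD (pair_conv_linear _).
- apply: lin_add; apply: lin_comp (triple_conv_linear _ _) _.
    exact: dbr_left_linear.
  apply: lin_comp (@P312_linear _ A) _; apply: lin_comp (dbr_left_linear d a) _.
  exact: tflip_linear.
move=> x y; rewrite pair_conv_pure !mD tflip_pure.
rewrite !dbr_left_pure triple_conv_purer triple_conv_P312 -!ad_symb.
by rewrite conv_comp_scalar (@amul0r K H) addr0.
Qed.

(** The skew-symmetry of the double bracket turns the flip of [{{b, c}}] into
    [- {{c, b}}], so both terms are iterated double brackets. *)
Lemma bracket_symb2 a b c al be ga :
  br (sym a al) (br (sym b be) (sym c ga)) =
  triple_conv (vform al) (vform be) (dbr_twice d a b c) ga -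
  triple_conv (vform be) (vform al) (P312 (dbr_twice d a c b)) ga.
Proof.
rewrite bracket_symb; transitivity (ad a al (pair_conv (vform be) (d (b ⊗ c))) ga).
  by [].
rewrite ad_pair_conv convD; congr (_ + _).
rewrite [d (b ⊗ c)]dbr_skew.
rewrite (linearEN _ (@tflip_linear _ _ _)) tflipK.
rewrite (linearEN _ (dbr_left_linear d a)) (linearEN _ (@P312_linear _ A)).
by rewrite (linearEN _ (triple_conv_linear _ _)).
Qed.

(** Cyclicity of the form, with the last two symbols of the word taken together
    as one factor. *)
Lemma triple_conv_rotate al be ga t :
  triple_conv (vform al) (vform be) (P312 t) ga =
  triple_conv (vform be) (vform ga) t al.
Proof.
move: t; apply: eq_tens_linear.
- apply: lin_comp (eval_linear ga) _.
  exact: lin_comp (triple_conv_linear _ _) (@P312_linear _ A).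
- exact: lin_comp (eval_linear al) (triple_conv_linear _ _).
move=> u z; move: u; apply: eq_tens_linear.
- apply: lin_comp (eval_linear ga) _.
  apply: lin_comp (triple_conv_linear _ _) _.
  by apply: lin_comp (@P312_linear _ A) _; lin.
- apply: lin_comp (eval_linear al) _.
  by apply: lin_comp (triple_conv_linear _ _) _; lin.
move=> x y; rewrite P312_pure !triple_conv_pure.
have := conv_form_cyclic v (sym z) (sym x ∙ vform be ∙ sym y) al ga.
by rewrite !amulA.
Qed.

Definition jacobiator (x y z : B) := br x (br y z) + br y (br z x) + br z (br x y).

(** Each of the three iterated brackets gives one positive and one negative term.
    [triple_conv_rotate] brings the positive ones to [ga] and the negative ones
    to [be], where each group assembles into a tribracket. *)
Lemma jacobiator_symb a b c al be ga :
  jacobiator (sym a al) (sym b be) (sym c ga) =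
  triple_conv (vform al) (vform be) (tribracket d (a ⊗ b ⊗ c)) ga -
  triple_conv (vform al) (vform ga) (tribracket d (a ⊗ c ⊗ b)) be.
Proof.
rewrite /jacobiator !bracket_symb2 !tribracket_pure.
rewrite !(linearED _ _ (triple_conv_linear _ _)) !convD !triple_conv_rotate.
set p := triple_conv _ _ _ _; set q := triple_conv _ _ _ _.
set r := triple_conv _ _ _ _; set s := triple_conv _ _ _ _.
set t := triple_conv _ _ _ _; set u := triple_conv _ _ _ _.
by rewrite !opprD !addrA [LHS](ACl (1*3*5*2*4*6)) /= [RHS](ACl (1*2*3*4*6*5)).
Qed.

Lemma jacobiatorC x y z : jacobiator x y z = jacobiator y z x.
Proof. by rewrite /jacobiator -addrA addrC. Qed.

(** By antisymmetry, the last two terms are the commutator at [x] of the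
    derivations [{y, -}] and [{z, -}]. *)
Lemma jacobiator_derivation y z : derivation (fun x => jacobiator x y z).
Proof.
have -> : (fun x => jacobiator x y z) =
    (fun x => br^~ (br y z) x + (br y (br z x) - br z (br y x))).
  apply/funext => x; rewrite /jacobiator -addrA (bracket_antisym y x).
  by rewrite (linearEN _ (derivation_bracketr z).1).
apply: derivationD (derivation_bracketl _) _.
exact: derivation_commutator (derivation_bracketr y) (derivation_bracketr z).
Qed.

End SymbolBracket.

(** * Invariance under the derivations delta *)

Section Invariance.
Variables (K : comPzRingType) (A : unitalAlgType K) (M : coalgType K).
Variables (d : double_bracket A) (v : cyclic_form M).
Local Notation B := (rep_alg_plus A M).
Local Notation H := (convolution M B).
Local Notation br := (rep_bracket_plus d v).
Local Notation vform := (conv_form v B).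
Local Notation sym := (@conv_symb K A M).

(** The derivation of the coalgebra given by [phi] is dual to commutation with
    [phi]. *)
Lemma commutator_scalar (f : H) phi al :
  f (delta_coalg phi al) = (f ∙ conv_scalar B phi - conv_scalar B phi ∙ f : H) al.
Proof.
have lf := conv_linear f.
rewrite convD convN !convM -tliftN -tliftD (tlift_lin _ _ lf).
apply: eq_tlift => x y; rewrite (linearED _ _ lf) (linearEN _ lf).
by rewrite !(linearEZ _ _ lf) amulZr amul1r amulZl amul1.
Qed.

Lemma derivation_delta phi : derivation (delta phi : B -> B).
Proof. by case: (deltaP A phi). Qed.

Local Notation delta_conv phi := (conv_comp (derivation_delta phi).1).

Lemma delta_conv_symb phi a : delta_conv phi (sym a) =
  sym a ∙ conv_scalar B phi - conv_scalar B phi ∙ sym a.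
Proof.
apply: convP => al; rewrite -commutator_scalar.
by case: (deltaP A phi) => _ _; exact.
Qed.

(** This is what makes the right-hand side of the quasi-Poisson identity vanish
    on invariants: cyclicity exchanges the roles of [al], where [delta] acts, and
    of [ga], where the convolution product is evaluated. *)
Lemma delta_form_symb a al ga : delta (form_at v ga) (sym a al) =
  (vform al ∙ sym a - sym a ∙ vform al : H) ga.
Proof.
transitivity (delta_conv (form_at v ga) (sym a) al) => //.
rewrite delta_conv_symb !convD !convN.
by rewrite (conv_form_left v (sym a) al ga) (conv_form_right v (sym a) al ga).
Qed.

(** Invariance of the form under the derivations of the coalgebra. *)
Lemma conv_form_delta phi al : vform (delta_coalg phi al) =
  conv_scalar B phi ∙ vform al - vform al ∙ conv_scalar B phi.
Proof.
have vC x y : vform x y = vform y x.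
  by rewrite -[vform x](@amul1r K H) conv_form_left (@amul1 K H).
apply: convP => ga; rewrite vC commutator_scalar !convD !convN.
by rewrite conv_form_left conv_form_right.
Qed.

(** Commuting [phi] past the whole word instead of past its two symbols costs
    the commutator of [phi] with the middle letter, which is the bracket of the
    symbol at [delta_coalg phi al]. *)
Lemma delta_pair_conv phi al t : delta_conv phi (pair_conv (vform al) t) =
  pair_conv (vform (delta_coalg phi al)) t +
  (pair_conv (vform al) t ∙ conv_scalar B phi -
   conv_scalar B phi ∙ pair_conv (vform al) t).
Proof.
have [lD mD] := conv_comp_derivation M (derivation_delta phi).
move: t; apply: eq_tens_linear.
- exact: lin_comp lD (pair_conv_linear _).
- by lin; exact: pair_conv_linear.
move=> x y; rewrite !pair_conv_pure conv_form_delta !mD conv_comp_scalar.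
rewrite (@amul0r K H) addr0 !delta_conv_symb.
rewrite !(@amulDl K H, @amulDr K H, @amulNl K H, @amulNr K H) !(@amulA K H).
by rewrite !addrA [LHS](ACl (1*4*3*2)).
Qed.

Lemma delta_bracket phi (x y : B) :
  delta phi (br x y) = br (delta phi x) y + br x (delta phi y).
Proof.
have dD := derivation_delta phi.
have dr x : derivation (br x) := derivation_bracketr d v x.
have dl y : derivation (br^~ y) := derivation_bracketl d v y.
(* In each variable in turn, two of the three terms form a commutator of
   derivations and the third is a derivation, so generators suffice. *)
suff H x' : delta phi (br x' y) - br (delta phi x') y = br x' (delta phi y).
  by rewrite -H addrC subrK.
move: x'; apply: derivation_ext.
- exact: derivation_commutator dD (dl y).
- exact: dl.
move=> a al; suff H y' : delta phi (br (sym a al) y') - br (sym a al) (delta phi y') =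
   br (delta phi (sym a al)) y' by rewrite -H opprB addrC subrK.
move: y'; apply: derivation_ext.
- exact: derivation_commutator dD (dr _).
- exact: dr.
move=> b be.
have dE c ga : delta phi (sym c ga) = sym c (delta_coalg phi ga).
  by case: (deltaP A phi) => _ _; exact.
rewrite !dE !bracket_symb commutator_scalar.
transitivity (delta_conv phi (pair_conv (vform al) (d (a ⊗ b))) be -
  (pair_conv (vform al) (d (a ⊗ b)) ∙ conv_scalar B phi -
   conv_scalar B phi ∙ pair_conv (vform al) (d (a ⊗ b)) : H) be) => //.
by rewrite delta_pair_conv convD addrK.
Qed.

(** The coefficients must not depend on [X]: they will be chosen before the first
    argument of the Jacobiator, which enters through [X] alone. *)
Definition coefficient_sum (F : H -> B) : Prop :=
  exists s : seq (B * M), forall X : H, F X = \sum_(p <- s) p.1 ∙ X p.2.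

(** This is where the commutativity of [B] lets the outer factors be collected in
    front of [X]. *)
Lemma coefficient_sandwich (f g : H) ga :
  coefficient_sum (fun X => (f ∙ X ∙ g : H) ga).
Proof.
exists [seq (f q.1 ∙ g p.2, q.2) | p <- repr (comul3 ga), q <- repr p.1] => X.
rewrite conv_sandwich big_allpairs_dep; apply: eq_bigr => p _.
by apply: eq_bigr => q _ /=; rewrite -amulA [X _ ∙ _]amulC amulA.
Qed.

Lemma coefficient_sumB (F G : H -> B) : coefficient_sum F -> coefficient_sum G ->
  coefficient_sum (fun X => F X - G X).
Proof.
move=> [s sF] [t tG]; exists (s ++ [seq (- p.1, p.2) | p <- t]) => X.
rewrite sF tG big_cat big_map -sumrN; congr (_ + _).
by apply: eq_bigr => p _; rewrite amulNl.
Qed.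

(** As [sym] is multiplicative and unital, the eight terms become words that pair
    off with opposite signs, in the order 1-7, 6-3, 8-4, 2-5 of the quasi-Poisson
    identity; the two words of a pair differ only in the side of [phi] on which
    [sym a] stands. *)
Lemma quasi_Poisson_triple (hd : quasi_Poisson d) a b c (phi psi : H) :
  let X := phi ∙ sym a - sym a ∙ phi in
  triple_conv phi psi (tribracket d (a ⊗ b ⊗ c)) =
  (sym c ∙ X ∙ (psi ∙ sym b) - aone ∙ X ∙ (psi ∙ sym b ∙ sym c)) -
  (sym c ∙ X ∙ (sym b ∙ psi) - aone ∙ X ∙ (sym b ∙ psi ∙ sym c)).
Proof.
move=> X; rewrite hd; have lt := @triple_conv_linear K A M phi psi.
rewrite !(linearED _ _ lt, linearEN _ lt) !triple_conv_pure.
rewrite !conv_symbM conv_symb1 /X !(@amul1 K H) !(@amul1r K H).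
rewrite !(@amulDl K H, @amulDr K H, @amulNl K H, @amulNr K H) !(@amulA K H).
rewrite !opprD !opprK !addrA.
by rewrite [RHS](ACl (1*7*4*6*8*3*2*5)).
Qed.

Lemma jacobiator_delta (hd : quasi_Poisson d) b c be ga :
  exists s : seq (B * M), forall x : B,
    jacobiator d v x (sym b be) (sym c ga) =
    \sum_(p <- s) p.1 ∙ delta (form_at v p.2) x.
Proof.
pose F b c be ga (X : H) : B :=
  ((sym c ∙ X ∙ (vform be ∙ sym b) : H) ga -
   (aone ∙ X ∙ (vform be ∙ sym b ∙ sym c) : H) ga) -
  ((sym c ∙ X ∙ (sym b ∙ vform be) : H) ga -
   (aone ∙ X ∙ (sym b ∙ vform be ∙ sym c) : H) ga).
have FP b1 c1 be1 ga1 : coefficient_sum (F b1 c1 be1 ga1).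
  by do 2![apply: coefficient_sumB]; exact: coefficient_sandwich.
have [s sF] := coefficient_sumB (FP b c be ga) (FP c b ga be).
exists s; apply: derivation_ext.
- exact: jacobiator_derivation.
- split=> [k x y|x y].
    rewrite scaler_sumr -big_split; apply: eq_bigr => p _ /=.
    by rewrite (derivation_delta _).1 amulDr amulZr.
  rewrite amul_suml amul_sumr -big_split; apply: eq_bigr => p _ /=.
  by rewrite (derivation_delta _).2 amulDr !amulA [p.1 ∙ x]amulC.
move=> a al; rewrite jacobiator_symb !quasi_Poisson_triple //.
under eq_bigr do rewrite delta_form_symb.
exact: sF.
Qed.

Lemma jacobiator_invariant (hd : quasi_Poisson d) (x y z : B) :
  (forall phi, delta phi x = 0) -> jacobiator d v x y z = 0.
Proof.
move=> Ex.
have d0 : derivation (fun _ : B => 0 : B).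
  by split=> [k u w|u w]; rewrite ?scaler0 ?amul0l ?amul0r addr0.
(* For fixed [x], reduce [y] and then [z] to generators. *)
rewrite jacobiatorC; move: y; apply: derivation_ext => // [|b be].
  exact: jacobiator_derivation.
rewrite jacobiatorC; move: z; apply: derivation_ext => // [|c ga].
  exact: jacobiator_derivation.
rewrite jacobiatorC; have [s ->] := jacobiator_delta hd b c be ga.
by rewrite big1 // => p _; rewrite Ex amul0r.
Qed.

Lemma bracket_invariants (x y : invariants A M) : in_invariants (br (\val x) (\val y)).
Proof.
have /asboolP Ex := valP x; have /asboolP Ey := valP y.
apply/asboolP => phi; rewrite delta_bracket Ex Ey.
rewrite (linearE0 (derivation_bracketl d v _).1).
by rewrite (linearE0 (derivation_bracketr d v _).1) addr0.
Qed.

End Invariance.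

(** * The Poisson algebra of invariants *)

Theorem theorem10p4 (K : comPzRingType) (A : unitalAlgType K)
    (d : double_bracket A) (hd : quasi_Poisson d)
    (M : coalgType K) (v : cyclic_form M) :
  exists br : invariants A M -> invariants A M -> invariants A M,
    (forall x y : invariants A M,
       invariants_val (br x y) = rep_bracket_plus d v (invariants_val x) (invariants_val y)) /\
    Poisson_bracket br.
Proof.
pose br x y : invariants A M := Sub _ (bracket_invariants d v x y).
have brE x y : \val (br x y) = rep_bracket_plus d v (\val x) (\val y) by rewrite SubK.
have dr x := derivation_bracketr d v x.
have dl y := derivation_bracketl d v y.
have lv : linear (\val : invariants A M -> rep_alg_plus A M) by exact: linearP.
have mv (x y : invariants A M) : \val (x ∙ y) = \val x ∙ \val y by [].
exists br; split; first exact: brE.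
split; first split=> x; first split=> [k y z|y z]; try apply: val_inj.
- by rewrite lv !brE lv (dr _).1.
- by rewrite (linearED _ _ lv) !mv !brE mv (dr _).2.
- split=> [k y z|y z]; apply: val_inj.
    by rewrite /= lv !brE lv (dl _).1.
  by rewrite /= (linearED _ _ lv) !mv !brE mv (dl _).2.
- by move=> x y; apply: val_inj; rewrite (linearEN _ lv) !brE bracket_antisym.
move=> x y z; apply: val_inj; rewrite !(linearED _ _ lv) (linearE0 lv) !brE.
by apply: jacobiator_invariant => //; exact/asboolP/(valP x).
Qed.
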